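(* Let $\mu=(\mu_1\ge\dots\ge\mu_n\ge0)$ and $\nu=(\nu_1\ge\dots\ge\nu_n\ge0)$ be partitions, each with no three equal parts, let $T$ be a shuffle tableau of shape $\mu\oslash\nu$, and let $i\ge1$. The crystal operators $E_i$ and $F_i$ do not change the Temperley–Lieb type: $\psi(E_iT)=\psi(T)$ whenever $E_iT$ is defined, and $\psi(F_iT)=\psi(T)$ whenever $F_iT$ is defined.
   Context: **Shuffle tableaux.** Put $m=\lceil n/2\rceil$, $\mathrm{start}(r)=2\nu_r+r-2m$, $\mathrm{end}(r)=2\mu_r+r-2m-2$. Positions $(r,c)$ have row $r$ (top to bottom) and column $c\in\mathbb Z$ (left to right). The squares of shape $\mu\oslash\nu$ are the $(r,c)$ with $1\le r\le n$, $c\equiv r \pmod 2$, $\mathrm{start}(r)\le c\le \mathrm{end}(r)$ (row $r$ has $\mu_r-\nu_r$ squares; if $\mu_r<\nu_r$ for some $r$ there are no tableaux of this shape). A shuffle tableau $T$ of shape $\mu\oslash\nu$ is a filling of these squares by positive integers, weakly increasing along each row from left to right and strictly increasing down each column (so the odd rows form a semistandard skew tableau and the even rows form another one). **Temperley–Lieb type $\psi(T)$.** By convention a position $(r,c)$ with $c\equiv r \pmod 2$, $1\le r\le n$, has value $T(r,c)$ if it is a square, $-\infty$ if $c<\mathrm{start}(r)$, $+\infty$ if $c>\mathrm{end}(r)$. Let $p_r=\mathrm{start}(r)-2$ if $r\ge2$ and $\nu_{r-1}=\nu_r$, and $p_r=\mathrm{start}(r)-1$ otherwise; $q_r=\mathrm{end}(r)+2$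 if $r<n$ and $\mu_r=\mu_{r+1}$, and $q_r=\mathrm{end}(r)+1$ otherwise. Take the graph on vertices $(r,c)$, $1\le r\le n$, $p_r\le c\le q_r$, with horizontal edges between consecutive vertices of each row. For every $1\le r<n$ and every $c\equiv r \pmod 2$ with $\mathrm{start}(r)\le c\le\mathrm{end}(r+1)+1$ such that the value at $(r+1,c-1)$ is $\le$ the value at $(r,c)$, replace the two horizontal edges $(r,c-1)\text{–}(r,c)$ and $(r+1,c-1)\text{–}(r+1,c)$ by the two vertical edges $(r,c-1)\text{–}(r+1,c-1)$ and $(r,c)\text{–}(r+1,c)$. Put $R_r$ at $(r,p_r)$ and $L_r$ at $(r,q_r)$. The resulting graph is a disjoint union of closed loops and $n$ strands matching the $2n$ endpoints $L_1,\dots,L_n,R_1,\dots,R_n$ (if $p_r=q_r$, the strand is the single vertex joining $L_r$ and $R_r$); this noncrossing perfect matching is $\psi(T)$ (loops are ignored). **Crystal operators.** For $i\ge1$, an $(i,i+1)$-overlap is a pair of squares in the same column containing $i$ and $i+1$. The word $w_i(T)$ is obtained by taking all squares containing $i$ or $i+1$, discarding those in $(i,i+1)$-overlap pairs, and reading the entries of the remaining squares row by row from the bottom row to the top row, left to right in each row. View each $i+1$ as ''('' and each $i$ as '')'' and match parentheses as usual. $E_i(T)$ is obtained by changing to $i$ the entry of the square giving the leftmost unmatched $i+1$ in $w_i(T)$ (undefined if there is none); $F_i(T)$ is obtained by changing to $i+1$ the entry of the square giving the rightmost unmatched $i$ (undefined if there is none). *)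

(* Defs.v *)
From mathcomp Require Import all_boot all_order all_algebra.
From mathcomp Require Import constructive_ereal.
Set Implicit Arguments.
Unset Strict Implicit.
Unset Printing Implicit Defensive.
Import Order.TTheory GRing.Theory Num.Theory.
Local Open Scope ring_scope.

Definition zrange (a b : int) : seq int :=
  if a <= b then [seq a + k%:Z | k <- iota 0 `|b - a|%N.+1] else [::].

Lemma mem_zrange (a b c : int) : (c \in zrange a b) = (a <= c <= b).
Proof.
rewrite /zrange; case: (leP a b) => [ab|ba]; last first.
  by rewrite in_nil; apply/esym/negP => /andP[ac cb]; move: (lt_le_trans ba ac);
     rewrite ltNge cb.
apply/mapP/andP => [[k]|[ac cb]].
  rewrite mem_iota add0n ltnS => kb ->; split; first by rewrite lerDl.
  rewrite -lerBrDl; apply: (le_trans (y := `|b - a|%N%:Z)) => //.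
  by rewrite gez0_abs // subr_ge0.
exists `|c - a|%N; last by rewrite gez0_abs ?subr_ge0 // addrCA subrr addr0.
rewrite mem_iota add0n ltnS leq0n -lez_nat !gez0_abs ?subr_ge0 //.
by rewrite lerB.
Qed.

(* A position (r, c): row r, counted from 1 at the top, and column c. *)
Definition position : Type := (nat * int)%type.

(* Only the values of a filling on the squares of the shape are meaningful;
   nothing below depends on its values elsewhere. *)
Definition filling : Type := position -> nat.

Definition is_partition (n : nat) (la : n.-tuple nat) : bool := sorted geq la.

(* The zeros among the n entries count as parts. *)
Definition no_three_equal_parts (n : nat) (la : n.-tuple nat) : Prop :=
  forall k : nat, (count_mem k la <= 2)%N.

Definition part (n : nat) (la : n.-tuple nat) (r : nat) : nat := nth 0%N la r.-1.

Section Shape.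

Variables (n : nat) (mu nu : n.-tuple nat).

Definition row_start (r : nat) : int :=
  2 * (part nu r)%:Z + r%:Z - 2 * (uphalf n)%:Z.

Definition row_end (r : nat) : int :=
  2 * (part mu r)%:Z + r%:Z - 2 * (uphalf n)%:Z - 2.

Definition same_parity (r : nat) (c : int) : bool := (c == r%:Z %[mod 2])%Z.

Definition row_squares (r : nat) : seq position :=
  [seq (r, c) | c <- zrange (row_start r) (row_end r) & same_parity r c].

(* In reading order: bottom row to top row, left to right in each row. *)
Definition squares : seq position :=
  flatten [seq row_squares r | r <- rev (iota 1 n)].

Lemma mem_squares (r : nat) (c : int) :
  ((r, c) \in squares) =
  [&& (1 <= r <= n)%N, same_parity r c & row_start r <= c <= row_end r].
Proof.
apply/flatten_mapP/and3P => [[r']|[rn rc cb]].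
  rewrite mem_rev mem_iota add1n ltnS => r'n /mapP[c'].
  by rewrite mem_filter mem_zrange => /andP[pc bc] [-> ->].
exists r; first by rewrite mem_rev mem_iota add1n ltnS.
by apply/mapP; exists c => //; rewrite mem_filter mem_zrange rc.
Qed.

Record is_shuffle_tableau (T : filling) : Prop := IsShuffleTableau {
  st_shape : forall r : nat, (1 <= r <= n)%N -> (part nu r <= part mu r)%N;
  st_pos : forall x : position, x \in squares -> (0 < T x)%N;
  st_row : forall (r : nat) (c c' : int),
    (r, c) \in squares -> (r, c') \in squares -> c <= c' ->
    (T (r, c) <= T (r, c'))%N;
  st_col : forall (r r' : nat) (c : int),
    (r, c) \in squares -> (r', c) \in squares -> (r < r')%N ->
    (T (r, c) < T (r', c))%N }.

Definition value (T : filling) (r : nat) (c : int) : \bar int :=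
  if c < row_start r then -oo%E
  else if row_end r < c then +oo%E
  else ((T (r, c))%:Z)%:E.

Definition left_col (r : nat) : int :=
  if (2 <= r)%N && (part nu r.-1 == part nu r)
  then row_start r - 2 else row_start r - 1.

Definition right_col (r : nat) : int :=
  if (r < n)%N && (part mu r == part mu r.+1)
  then row_end r + 2 else row_end r + 1.

Definition vertices : seq position :=
  flatten [seq [seq (r, c) | c <- zrange (left_col r) (right_col r)]
          | r <- iota 1 n].

Lemma mem_vertices (r : nat) (c : int) :
  ((r, c) \in vertices) = (1 <= r <= n)%N && (left_col r <= c <= right_col r).
Proof.
apply/flatten_mapP/andP => [[r']|[rn cb]].
  by rewrite mem_iota add1n ltnS => r'n /mapP[c']; rewrite mem_zrange => ? [-> ->].
exists r; first by rewrite mem_iota add1n ltnS.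
by apply/mapP; exists c => //; rewrite mem_zrange.
Qed.

(* The horizontal edges (r, c-1)-(r, c) and (r+1, c-1)-(r+1, c) are replaced by
   the vertical edges (r, c-1)-(r+1, c-1) and (r, c)-(r+1, c). *)
Definition uncrossed (T : filling) (r : nat) (c : int) : bool :=
  [&& (1 <= r < n)%N, same_parity r c,
      row_start r <= c <= row_end r.+1 + 1
    & (value T r.+1 (c - 1) <= value T r c)%E].

(* Edges oriented to the right or downwards. The edge (r, c)-(r, c+1) may be
   removed together with an edge of row r+1 or of row r-1. *)
Definition arrow (T : filling) (x y : position) : bool :=
  let: (r, c) := x in
     [&& y == (r, c + 1), ~~ uncrossed T r (c + 1)
       & ~~ uncrossed T r.-1 (c + 1)]
  || (y == (r.+1, c)) && (uncrossed T r c || uncrossed T r (c + 1)).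

Definition edge (T : filling) : rel (seq_sub vertices) :=
  fun x y => arrow T (val x) (val y) || arrow T (val y) (val x).

(* [inl r] is the endpoint L_{r+1} and [inr r] is the endpoint R_{r+1}. *)
Definition endpoint : finType := ('I_n + 'I_n)%type.

Definition endpoint_pos (a : endpoint) : position :=
  match a with
  | inl r => (r.+1, right_col r.+1)
  | inr r => (r.+1, left_col r.+1)
  end.

Definition joined (T : filling) (a b : endpoint) : bool :=
  [exists x : seq_sub vertices, exists y : seq_sub vertices,
    [&& val x == endpoint_pos a, val y == endpoint_pos b
      & connect (edge T) x y]].

(* The matching, as the set of its blocks {a, b}. *)
Definition psi (T : filling) : {set {set endpoint}} :=
  [set S : {set endpoint} | [exists a : endpoint, exists b : endpoint,
    [&& a != b, joined T a b & S == [set a; b]]]].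

Definition in_overlap (i : nat) (T : filling) (x : position) : bool :=
  has (fun y : position => (y.2 == x.2) &&
         ((T x == i) && (T y == i.+1) || (T x == i.+1) && (T y == i)))
      squares.

(* The squares whose entries form the word w_i(T). *)
Definition word (i : nat) (T : filling) : seq position :=
  [seq x <- squares | ((T x == i) || (T x == i.+1)) && ~~ in_overlap i T x].

End Shape.

(* Parenthesis matching, scanning w from left to right. The result is the pair
   of the unmatched squares with entry i and the unmatched squares with entry
   i+1; both lists are in reverse order, i.e. rightmost square first. *)
Fixpoint bracket (i : nat) (T : filling) (closes opens w : seq position)
    : seq position * seq position :=
  match w with
  | [::] => (closes, opens)
  | x :: w' =>
    if T x == i.+1 then bracket i T closes (x :: opens) w'
    else match opens with
         | [::] => bracket i T (x :: closes) [::] w'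
         | _ :: opens' => bracket i T closes opens' w'
         end
  end.

Definition set_entry (T : filling) (x : position) (k : nat) : filling :=
  fun y => if y == x then k else T y.

(* [None] when the operator is undefined. *)
Definition crystal_E (n : nat) (mu nu : n.-tuple nat) (i : nat) (T : filling)
    : option filling :=
  let: (_, opens) := bracket i T [::] [::] (word mu nu i T) in
  omap (fun x => set_entry T x i) (ohead (rev opens)).

Definition crystal_F (n : nat) (mu nu : n.-tuple nat) (i : nat) (T : filling)
    : option filling :=
  let: (closes, _) := bracket i T [::] [::] (word mu nu i T) in
  omap (fun x => set_entry T x i.+1) (ohead closes).

(* Main.v *)
Require Import Defs.
From mathcomp Require Import all_boot all_order all_algebra zify constructive_ereal.
Set Implicit Arguments.
Unset Strict Implicit.
Unset Printing Implicit Defensive.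
Import Order.TTheory GRing.Theory Num.Theory.

(* Write e_r(c) for the event that (r, c) is uncrossed; a tableau is then a word
   in the Temperley-Lieb generators e_r, read by increasing column c. Changing
   the entry of x = (r, c) from i+1 to i affects only two of them: e_{r-1}(c+1)
   is gained iff (r-1, c+1) has entry i, and e_r(c) is lost iff (r+1, c-1) has
   entry i+1. When the latter square is in an overlap, the word contains
   e_{r-1}(c-1) e_r(c) e_{r-1}(c+1), and losing e_r(c) is the relation
   e_{r-1} e_r e_{r-1} = e_{r-1}. Otherwise it is the end of a run of
   unoverlapped i+1's, say of length l; these are matched by l unoverlapped i's
   to the left of x, so that e_r(c-2l) is present and no generator with index
   r-1, r or r+1 lies between columns c-2l and c: losing e_r(c) is the relation
   e_r e_r = e_r up to a loop. The gain is symmetric. Both relations come from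
   the same picture: flipping one crossing on a closed loop merges the loop with
   a strand, or splits it off, and does not affect the other connections.
   E_i and F_i are treated at once, because the split point x of the word has the
   same matching property for both: before x no suffix has an excess of i+1's, and
   after x no prefix has an excess of i's. *)

(* The type annotation matters: in (r, c - 1) the second type is otherwise inferred
   as a structure projection, and lia then does not identify equal entries. *)
Local Notation pos r c := (@pair nat int r c%R).

(** * Shapes *)

Lemma same_parityS (r : nat) (c : int) : same_parity r.+1 c = ~~ same_parity r c.
Proof. by rewrite /same_parity; lia. Qed.

Lemma same_parity_sub (r : nat) (c : int) (k : nat) :
  same_parity r (c - 2 * k%:Z)%R = same_parity r c.
Proof. by rewrite /same_parity; lia. Qed.

Section Shape.

Local Open Scope ring_scope.

Variable n : nat.

Lemma part_anti (la : n.-tuple nat) (r r' : nat) :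
  is_partition la -> (1 <= r <= r')%N -> (r' <= n)%N ->
  (part la r' <= part la r)%N.
Proof.
move=> la_part r_le r'n; rewrite /part.
have geq_trans : transitive geq by move=> a b c; rewrite /= => ba ac; lia.
have := @sorted_leq_nth _ _ geq_trans (fun a => leqnn a) 0%N _ la_part.
by move=> /(_ r.-1 r'.-1); rewrite !inE !size_tuple /=; apply; lia.
Qed.

Lemma part_lt2 (la : n.-tuple nat) (r : nat) :
  is_partition la -> no_three_equal_parts la -> (1 <= r)%N -> (r.+2 <= n)%N ->
  (part la r.+2 < part la r)%N.
Proof.
move=> la_part la3 r1 rn.
rewrite ltn_neqAle part_anti ?andbT //; last by lia.
apply/eqP => eq_r; have := la3 (part la r); apply/negP; rewrite -ltnNge.
have eq_r1 : part la r.+1 = part la r.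
  by apply/eqP; rewrite eqn_leq -{2}eq_r !part_anti //; lia.
rewrite -(cat_take_drop r.-1 la) count_cat.
rewrite 3?(drop_nth 0%N) ?size_tuple; try lia.
move: eq_r eq_r1; rewrite /part /= prednK // => -> ->.
by rewrite !eqxx /=; lia.
Qed.

Variables mu nu : n.-tuple nat.

(** The extra columns granted by [left_col] and [right_col] for equal parts are exactly what is
    needed: if nu_r = nu_{r+1}, then start(r) - 1 = start(r+1) - 2, and if mu_r = mu_{r+1}, then
    end(r+1) + 1 = end(r) + 2. *)
Lemma corners_in_vertices (r : nat) (c : int) :
  is_partition mu -> is_partition nu -> (1 <= r < n)%N ->
  row_start nu r <= c <= row_end mu r.+1 + 1 ->
  [/\ left_col nu r <= c - 1, c <= right_col mu r, left_col nu r.+1 <= c - 1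
    & c <= right_col mu r.+1].
Proof.
move=> mu_part nu_part rn.
have mu_r : (part mu r.+1 <= part mu r)%N by apply: part_anti => //; lia.
have nu_r : (part nu r.+1 <= part nu r)%N by apply: part_anti => //; lia.
rewrite /left_col /right_col /= /row_start /row_end.
by move=> cP; split; case: ifP => ?; lia.
Qed.

Hypotheses (mu_part : is_partition mu) (nu_part : is_partition nu).
Hypotheses (mu3 : no_three_equal_parts mu) (nu3 : no_three_equal_parts nu).

(** Going down two rows shifts the columns by 2, which is made up for by twice the strict drop of
    [part_lt2]. Hence the rows of one parity form a skew shape. *)
Lemma row_bounds_anti (r r' : nat) :
  (1 <= r <= r')%N -> (r' <= n)%N -> odd r = odd r' ->
  row_start nu r' <= row_start nu r /\ row_end mu r' <= row_end mu r.
Proof.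
move=> rr' r'n odd_r; have [k def_r'] : exists k, r' = (r + k.*2)%N.
  by exists (r' - r)./2; lia.
rewrite {r' odd_r}def_r' in rr' r'n *.
elim: k rr' r'n => [|k IHk] rr' r'n; first by rewrite addn0.
have [] := IHk _ _; try lia.
have := @part_lt2 mu (r + k.*2) mu_part mu3; have := @part_lt2 nu (r + k.*2) nu_part nu3.
have -> : (r + k.+1.*2 = (r + k.*2).+2)%N by lia.
by rewrite /row_start /row_end; split; lia.
Qed.

Lemma square_between (r r' r'' : nat) (c : int) :
  (r, c) \in squares mu nu -> (r'', c) \in squares mu nu ->
  (r <= r' <= r'')%N -> odd r = odd r' -> (r', c) \in squares mu nu.
Proof.
rewrite !mem_squares /same_parity => /and3P[rn rc rb] /and3P[r''n r''c r''b] r'P r'o.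
have := @row_bounds_anti r r' _ _ r'o; have := @row_bounds_anti r' r''; lia.
Qed.

Lemma squareP (r : nat) (c : int) :
  reflect [/\ (1 <= r <= n)%N, same_parity r c, row_start nu r <= c
             & c <= row_end mu r] ((r, c) \in squares mu nu).
Proof.
by rewrite mem_squares; apply: (iffP and3P) => [[-> -> /andP[-> ->]]|[-> -> -> ->]].
Qed.

Lemma square_in_row (r : nat) (c c' d : int) :
  (r, c) \in squares mu nu -> (r, c') \in squares mu nu ->
  same_parity r d -> c <= d <= c' -> (r, d) \in squares mu nu.
Proof.
move=> /squareP[rn _ cl _] /squareP[_ _ _ cr'] rd /andP[cd dc'].
by apply/squareP; split=> //; [exact: le_trans cl cd | exact: le_trans dc' cr'].
Qed.

(** A skew shape contains the rectangle spanned by a north-west and a south-east square; this is its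
    north-east corner, and [square_below] gives the south-west one. *)
Lemma square_above (r r' : nat) (c c' : int) :
  (r, c) \in squares mu nu -> (r', c') \in squares mu nu ->
  (r <= r')%N -> odd r = odd r' -> c <= c' -> (r, c') \in squares mu nu.
Proof.
move=> /squareP[rn rc cl _] /squareP[r'n r'c' _ cr'] rr' r_odd cc'.
have [|||_ end_le] := @row_bounds_anti r r' => //; [lia | lia |].
apply/squareP; split=> //; [|exact: le_trans cl cc'|exact: le_trans cr' end_le].
by move: r'c'; rewrite /same_parity; clear -r_odd; lia.
Qed.

Lemma square_below (r r' : nat) (c c' : int) :
  (r, c) \in squares mu nu -> (r', c') \in squares mu nu ->
  (r <= r')%N -> odd r = odd r' -> c <= c' -> (r', c) \in squares mu nu.
Proof.
move=> /squareP[rn rc cl _] /squareP[r'n r'c' _ cr'] rr' r_odd cc'.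
have [|||start_le _] := @row_bounds_anti r r' => //; [lia | lia |].
apply/squareP; split=> //; [|exact: le_trans start_le cl|exact: le_trans cc' cr'].
by move: rc; rewrite /same_parity; clear -r_odd; lia.
Qed.

(* For c in the range of [uncrossed], the positions (r, c) and (r+1, c-1) can
   fail to be squares only by having the values +oo and -oo. *)
Lemma uncrossedE (T : filling) (r : nat) (c : int) :
  uncrossed mu nu T r c =
  [&& (1 <= r < n)%N, same_parity r c,
      row_start nu r <= c <= row_end mu r.+1 + 1
    & [|| c - 1 < row_start nu r.+1, row_end mu r < c
        | (T (pos r.+1 (c - 1)) <= T (pos r c))%N]].
Proof.
rewrite /uncrossed; case rn: (1 <= r < n)%N => //=; case: same_parity => //=.
case cP: (row_start nu r <= c <= _) => //=; have /andP[cl cr] := cP; rewrite /value.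
case: ifP => [_|lt_c] /=; first by rewrite leNye.
have /negbTE -> : ~~ (row_end mu r.+1 < c - 1) by rewrite -leNgt; lia.
rewrite (ltNge c) cl /=; case: ifP => _ /=; first by rewrite leey.
by rewrite lee_fin.
Qed.

Lemma uncrossed_intro (T : filling) (r : nat) (c : int) :
  (1 <= r < n)%N -> same_parity r c -> row_start nu r <= c ->
  c - 1 <= row_end mu r.+1 ->
  ((r.+1, c - 1) \in squares mu nu -> (r, c) \in squares mu nu ->
   (T (pos r.+1 (c - 1)) <= T (pos r c))%N) ->
  uncrossed mu nu T r c.
Proof.
move=> rn rc cl cr le_T; rewrite uncrossedE rn rc cl /=; apply/andP; split.
  by move: cr; clear; lia.
have [//|cl'] := ltP (c - 1); have [//|cr'] := ltP _ c; apply: le_T; apply/squareP.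
  split=> //; first by move: rn; clear; lia.
  by move: rc; rewrite /same_parity; clear; lia.
by split=> //; move: rn; clear; lia.
Qed.

Lemma uncrossed_elim (T : filling) (r : nat) (c : int) :
  uncrossed mu nu T r c -> row_start nu r.+1 <= c - 1 -> c <= row_end mu r ->
  [/\ (r.+1, c - 1) \in squares mu nu, (r, c) \in squares mu nu
    & (T (pos r.+1 (c - 1)) <= T (pos r c))%N].
Proof.
rewrite uncrossedE => /and4P[rn rc /andP[cl cr] +] cl' cr'.
rewrite !ltNge cl' cr' /=; split=> //; apply/squareP; split=> //.
- by move: rn; clear; lia.
- by move: rc; rewrite /same_parity; clear; lia.
- by move: cr; clear; lia.
by move: rn; clear; lia.
Qed.

Lemma row_step (r : nat) : (1 <= r < n)%N ->
  row_start nu r.+1 <= row_start nu r + 1 /\ row_end mu r.+1 <= row_end mu r + 1.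
Proof.
move=> rn; have := @part_anti mu r r.+1 mu_part; have := @part_anti nu r r.+1 nu_part.
by rewrite /row_start /row_end; lia.
Qed.

Lemma row_step2 (r : nat) : (1 <= r)%N -> (r.+2 <= n)%N ->
  row_start nu r.+2 <= row_start nu r /\ row_end mu r.+2 <= row_end mu r.
Proof.
by move=> r1 rn; apply: row_bounds_anti; rewrite ?r1 ?(leqW (leqnSn r)) //= negbK.
Qed.

End Shape.

(** * Parenthesis matching *)

Section Bracketing.

Variables (i : nat) (T : filling).

Let opening (x : position) : bool := T x == i.+1.
Let opens (w : seq position) : nat := count opening w.
(** As in [bracket], every letter other than i+1 closes; in [word mu nu i T] such a letter is an
    i. *)
Let closes (w : seq position) : nat := count (predC opening) w.

Definition no_open_suffix (w : seq position) : Prop :=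
  forall w1 w2, w = w1 ++ w2 -> opens w2 <= closes w2.

Definition no_close_prefix (w : seq position) : Prop :=
  forall w1 w2, w = w1 ++ w2 -> closes w1 <= opens w1.

Lemma bracket_cat (cl op w1 w2 : seq position) :
  bracket i T cl op (w1 ++ w2) =
  bracket i T (bracket i T cl op w1).1 (bracket i T cl op w1).2 w2.
Proof.
elim: w1 cl op => //= x w1 IHw cl op.
by case: ifP => _; [exact: IHw | case: op => [|y op]; exact: IHw].
Qed.

Lemma no_open_suffix_rcons w z :
  ~~ opening z ->
  (forall w1 w2, w = w1 ++ w2 -> opens w2 <= (closes w2).+1) ->
  no_open_suffix (rcons w z).
Proof.
move=> zF wP w1 w2; case: (lastP w2) => [|w2' y]; first by rewrite /closes /opens.
rewrite -rcons_cat => /rcons_inj[/wP le_w2 <-].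
by move: le_w2; rewrite /opens /closes -!cats1 !count_cat /= zF (negbTE zF); lia.
Qed.

Lemma no_close_prefix_rcons w z :
  (opening z \/ closes w < opens w) -> no_close_prefix w ->
  no_close_prefix (rcons w z).
Proof.
move=> zP wP w1 w2; case: (lastP w2) => [|w2' y]; last first.
  by rewrite -rcons_cat => /rcons_inj[/wP].
rewrite cats0 => <-; move: (wP w [::]) zP; rewrite cats0 => /(_ erefl).
rewrite /closes /opens -cats1 !count_cat /=.
by case: (opening z) => /=; lia.
Qed.

Definition unmatched_split (w : seq position) (x : position)
    (w1 w2 : seq position) : Prop :=
  [/\ w = w1 ++ x :: w2, no_open_suffix w1 & no_close_prefix w2].

(** Induction on the last letter. The surplus of i+1's after the split point is recorded because a
    closing letter may be appended to [w2] only when a pending i+1 there absorbs it. The lists being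
    reversed, the leftmost unmatched i+1 is the last element of [op] and the rightmost unmatched i
    is the head of [cl]. *)
Lemma bracketP (w : seq position) :
  let: (cl, op) := bracket i T [::] [::] w in
  [/\ op = [::] -> no_open_suffix w,
      forall op' x, op = rcons op' x ->
        opening x /\ exists w1 w2, unmatched_split w x w1 w2 /\
          opens w2 = size op' + closes w2,
      cl = [::] -> no_close_prefix w /\ opens w = size op + closes w
    & forall cl' x, cl = x :: cl' ->
        ~~ opening x /\ exists w1 w2, unmatched_split w x w1 w2 /\
          opens w2 = size op + closes w2].
Proof.
elim/last_ind: w => [|w z IHw] /=.
  split=> // => [_ [|? ?] [|? ?] // | [|? ?] ? //|_].
  by split=> // [[|? ?]].
rewrite -cats1 bracket_cat /=.
case E: (bracket i T [::] [::] w) IHw => [cl op] /= [IH1 IH2 IH3 IH4].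
rewrite -/(opening z); case: (boolP (opening z)) => zO.
  split=> //.
  - case: (lastP op) IH1 IH2 {E IH3 IH4} => [|op' x] IH1 IH2 op0 y.
      case: op0 => [[<-]|? [|? ?]//]; split=> //; exists w, [::].
      by split=> //; split=> //; [exact: IH1 | case].
    rewrite -rcons_cons => /rcons_inj[<- <-].
    have [xO [w1 [w2 [[-> w1P w2P] sz]]]] := IH2 _ _ erefl.
    split=> //; exists w1, (rcons w2 z); split.
      split=> //; first by rewrite -cats1 -catA.
      by apply: no_close_prefix_rcons => //; left.
    by move: sz; rewrite /opens /closes -cats1 !count_cat /= zO; lia.
  - move=> /IH3[wP sz]; split.
      by rewrite cats1; apply: no_close_prefix_rcons => //; left.
    by move: sz; rewrite /opens /closes !count_cat /= zO; lia.
  - move=> cl' x /IH4[xO [w1 [w2 [[-> w1P w2P] sz]]]].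
    split=> //; exists w1, (rcons w2 z); split.
      split=> //; first by rewrite -cats1 -catA.
      by apply: no_close_prefix_rcons => //; left.
    by move: sz; rewrite /opens /closes -cats1 !count_cat /= zO; lia.
case: op E IH1 IH2 IH3 IH4 => [|y op] E IH1 IH2 IH3 IH4.
  split=> //.
  - by move=> _; rewrite cats1; apply: no_open_suffix_rcons => // w1 w2 /(IH1 erefl)/leqW.
  - by case.
  - move=> cl' x [<- _]; split=> //; exists w, [::]; split=> //.
    by split=> //; [exact: IH1 | case].
split.
(* Here [z] matches [y], the only pending i+1. A suffix of [w] inside [w2] has no excess of i+1's,
   because [w2] is balanced and its prefixes have no excess of i's; a longer suffix has excess at
   most 1, coming from [y], and [z] cancels it. *)
- move=> op0; subst op.
  have [yO [w1 [w2 [[-> w1P w2P] sz]]]] := IH2 [::] y erefl.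
  rewrite cats1; apply: no_open_suffix_rcons => // u1 u2.
  case: (ltnP (size w1) (size u1)) => lt_u.
    move=> Ew; have Eu : u1 = w1 ++ y :: take (size u1 - size w1).-1 w2.
      rewrite -[LHS](take_size_cat u2 (erefl (size u1))) -Ew take_cat.
      rewrite ltnNge (ltnW lt_u) /=.
      by have {1}-> // : size u1 - size w1 = (size u1 - size w1).-1.+1 by lia.
    move: Ew; rewrite {1}Eu -catA => /eqP; rewrite eqseq_cat // eqxx /=.
    rewrite eqseq_cons eqxx /= => /eqP Ew2.
    move: sz (w2P _ _ Ew2); rewrite {1 2}Ew2 /opens /closes !count_cat /=.
    by lia.
  move=> Ew; have Eu : u2 = drop (size u1) w1 ++ y :: w2.
    rewrite -[LHS](drop_size_cat u2 (erefl (size u1))) -Ew drop_cat.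
    rewrite ltn_neqAle lt_u andbT.
    by case: eqP => //= ->; rewrite subnn drop_size.
  have := w1P (take (size u1) w1) (drop (size u1) w1).
  rewrite cat_take_drop => /(_ erefl).
  by move: sz; rewrite Eu /opens /closes !count_cat /= yO; lia.
- move=> op' x Eop; have := IH2 (y :: op') x; rewrite Eop rcons_cons.
  move=> /(_ erefl)[xO [w1 [w2 [[-> w1P w2P] sz]]]]; split=> //.
  exists w1, (rcons w2 z); split.
    split=> //; first by rewrite -cats1 -catA.
    by apply: no_close_prefix_rcons => //; right; rewrite sz /=; lia.
  by move: sz; rewrite /opens /closes -cats1 !count_cat /= (negbTE zO); lia.
- move=> /IH3[wP sz]; split.
    rewrite cats1; apply: no_close_prefix_rcons => //; right.
    by move: sz => /=; lia.
  by move: sz; rewrite /opens /closes !count_cat /= (negbTE zO); lia.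
- move=> cl' x /IH4[xO [w1 [w2 [[-> w1P w2P] sz]]]].
  split=> //; exists w1, (rcons w2 z); split.
    split=> //; first by rewrite -cats1 -catA.
    by apply: no_close_prefix_rcons => //; right; move: sz => /=; lia.
  by move: sz; rewrite /opens /closes -cats1 !count_cat /= (negbTE zO); lia.
Qed.

End Bracketing.

Lemma crystal_EP (n : nat) (mu nu : n.-tuple nat) (i : nat) (T ET : filling) :
  crystal_E mu nu i T = Some ET ->
  exists x, [/\ ET = set_entry T x i, T x = i.+1 &
    exists w1 w2, unmatched_split i T (word mu nu i T) x w1 w2].
Proof.
rewrite /crystal_E; have := @bracketP i T (word mu nu i T).
case: (bracket i T [::] [::] (word mu nu i T)) => cl op [_ IH _ _].
case: (lastP op) IH => // op' x IH; rewrite rev_rcons /= => -[<-].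
have [/eqP Tx [w1 [w2 [wP _]]]] := IH _ _ erefl.
by exists x; split=> //; exists w1, w2.
Qed.

Lemma crystal_FP (n : nat) (mu nu : n.-tuple nat) (i : nat) (T FT : filling) :
  crystal_F mu nu i T = Some FT ->
  exists x, [/\ FT = set_entry T x i.+1, T x = i &
    exists w1 w2, unmatched_split i T (word mu nu i T) x w1 w2].
Proof.
rewrite /crystal_F; have := @bracketP i T (word mu nu i T).
case: (bracket i T [::] [::] (word mu nu i T)) => cl op [_ _ _ IH].
case: cl IH => // x cl' IH /= [<-].
have [Tx [w1 [w2 [wP _]]]] := IH _ _ erefl.
exists x; split=> //; last by exists w1, w2.
have : x \in word mu nu i T by case: wP => -> _ _; rewrite mem_cat inE eqxx orbT.
by rewrite mem_filter (negbTE Tx) orbF => /andP[/andP[/eqP]].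
Qed.

(** * The word of a tableau *)

Lemma count_le_size (A : eqType) (P : pred A) (v L : seq A) :
  uniq v -> (forall z, z \in v -> P z -> z \in L) -> count P v <= size L.
Proof.
move=> v_uniq PL; rewrite -size_filter; apply: uniq_leq_size.
  exact: filter_uniq.
by move=> z; rewrite mem_filter => /andP[Pz /PL]; apply.
Qed.

Lemma size_le_count (A : eqType) (P : pred A) (v L : seq A) :
  uniq L -> (forall z, z \in L -> (z \in v) && P z) -> size L <= count P v.
Proof.
move=> L_uniq LP; rewrite -size_filter; apply: uniq_leq_size => // z /LP.
by rewrite mem_filter andbC.
Qed.

Section ReadingOrder.

Local Open Scope ring_scope.

Variables (n : nat) (mu nu : n.-tuple nat).

Definition read_before (x y : position) : bool :=
  (y.1 < x.1)%N || (x.1 == y.1) && (x.2 < y.2).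

Lemma pairwise_squares : pairwise read_before (squares mu nu).
Proof.
rewrite /squares; have : pairwise (fun r r' => r' < r)%N (rev (iota 1 n)).
  rewrite -sorted_pairwise; last by move=> ? ? ? /= ? ?; lia.
  by rewrite rev_sorted; exact: iota_ltn_sorted.
elim: (rev (iota 1 n)) => //= r rs IHrs /andP[/allP r_rs /IHrs rsP].
rewrite pairwise_cat rsP andbT; apply/andP; split.
  apply/allrelP => x y /mapP[c _ ->] /flatten_mapP[r' /r_rs r'r /mapP[c' _ ->]].
  by rewrite /read_before /= r'r.
rewrite /row_squares pairwise_map pairwise_filter //.
rewrite /zrange; case: ifP => // _; rewrite pairwise_map.
apply: sub_pairwise (_ : pairwise ltn _); last first.
  by rewrite -sorted_pairwise; [exact: iota_ltn_sorted | exact: ltn_trans].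
by move=> k k' /= kk'; rewrite /read_before /= eqxx; lia.
Qed.

Variables (i : nat) (T : filling).
Hypothesis T_tab : is_shuffle_tableau mu nu T.
Hypotheses (mu_part : is_partition mu) (nu_part : is_partition nu).
Hypotheses (mu3 : no_three_equal_parts mu) (nu3 : no_three_equal_parts nu).

Local Notation sq x := (x \in squares mu nu).
Local Notation w := (word mu nu i T).

Lemma pairwise_word : pairwise read_before w.
Proof. exact/pairwise_filter/pairwise_squares. Qed.

Lemma mem_word (x : position) :
  (x \in w) = [&& sq x, (T x == i) || (T x == i.+1) & ~~ in_overlap mu nu i T x].
Proof. by rewrite mem_filter andbC andbA. Qed.

Lemma square_odd (r r' : nat) (c : int) : sq (r, c) -> sq (r', c) -> odd r = odd r'.
Proof.
move=> /squareP[_ rc _ _] /squareP[_ r'c _ _].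
by move: rc r'c; rewrite /same_parity; lia.
Qed.

Lemma col_lt (r r' : nat) (c : int) :
  sq (r, c) -> sq (r', c) -> (T (pos r c) < T (pos r' c))%N -> (r < r')%N.
Proof.
move=> rP r'P lt_T; rewrite ltnNge leq_eqVlt; apply/negP => /orP[/eqP E|r'r].
  by rewrite E ltnn in lt_T.
by have := st_col T_tab r'P rP r'r; lia.
Qed.

(** Columns have no gaps within a parity class, and a square strictly in between would need an entry
    strictly between consecutive integers. So the two squares of an overlap are always two rows
    apart. *)
Lemma col_succ (r r' : nat) (c : int) :
  sq (r, c) -> sq (r', c) -> T (pos r' c) = (T (pos r c)).+1 -> r' = r.+2.
Proof.
move=> rP r'P E; have rr' : (r < r')%N by apply: (col_lt rP r'P); rewrite E.
have odd_r := square_odd rP r'P; case: (ltnP r.+2 r') => [r2|]; last by lia.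
have mid : sq (r.+2, c).
  by apply: (@square_between _ mu nu _ _ _ _ r _ r') => //; [lia | rewrite /= negbK].
have := st_col T_tab rP mid (leqnSn _); have := st_col T_tab mid r'P r2.
by rewrite E; lia.
Qed.

Lemma overlap_below (r : nat) (c : int) : sq (r, c) -> T (pos r c) = i ->
  in_overlap mu nu i T (pos r c) = sq (r.+2, c) && (T (r.+2, c) == i.+1).
Proof.
move=> rP Ti; apply/hasP/andP => [[[r' c'] yP /= /andP[/eqP Ec /orP[/andP[_ /eqP T1]|/andP[/eqP]]]]|[yP /eqP T1]].
- by subst c'; have Er := col_succ rP yP (etrans T1 (esym (congr1 S Ti))); rewrite -Er yP T1.
- by rewrite Ti; lia.
by exists (r.+2, c) => //=; rewrite Ti T1 !eqxx.
Qed.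

Lemma overlap_above (r : nat) (c : int) : sq (r, c) -> T (pos r c) = i.+1 ->
  in_overlap mu nu i T (pos r c) ->
  exists r', [/\ r = r'.+2, sq (r', c) & T (pos r' c) = i].
Proof.
move=> rP Ti /hasP[[r' c'] yP /= /andP[/eqP Ec /orP[/andP[/eqP]|/andP[_ /eqP T1]]]].
  by rewrite Ti; lia.
subst c'; exists r'; split=> //.
by apply: (col_succ yP rP); rewrite Ti T1.
Qed.

Lemma in_overlap_lower (r : nat) (c : int) :
  sq (r, c) -> T (pos r c) = i -> sq (r.+2, c) -> T (r.+2, c) = i.+1 ->
  in_overlap mu nu i T (r.+2, c).
Proof. by move=> rP Ti r2P Ti1; apply/hasP; exists (r, c); rewrite //= Ti Ti1 !eqxx orbT. Qed.

(** * The tableau around the split point of the word *)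

Variables (r : nat) (c : int) (w1 w2 : seq position).
Hypothesis xP : unmatched_split i T w (r, c) w1 w2.

Let w_eq : w = w1 ++ (r, c) :: w2. Proof. by case: xP. Qed.

Lemma split_word : (r, c) \in w.
Proof. by rewrite w_eq mem_cat inE eqxx orbT. Qed.

Lemma split_square : sq (r, c).
Proof. by have := split_word; rewrite mem_word => /and3P[]. Qed.

Lemma split_entry : T (pos r c) = i \/ T (pos r c) = i.+1.
Proof. by have := split_word; rewrite mem_word => /and3P[_ /orP[]/eqP ->]; auto. Qed.

Lemma split_not_overlap : ~~ in_overlap mu nu i T (pos r c).
Proof. by have := split_word; rewrite mem_word => /and3P[]. Qed.

Lemma split_left (y : position) : (y \in w1) = (y \in w) && read_before y (r, c).
Proof.
have := pairwise_word; rewrite w_eq pairwise_cat /= => /and3P[/allrelP lt1 _ /andP[/allP lt2 _]].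
rewrite mem_cat inE; apply/idP/idP => [yw1|/andP[/or3P[]//]].
  by rewrite yw1 lt1 // inE eqxx.
  by move=> /eqP -> ; rewrite /read_before /=; lia.
by move=> /lt2; rewrite /read_before /=; lia.
Qed.

Lemma split_right (y : position) : (y \in w2) = (y \in w) && read_before (r, c) y.
Proof.
have := pairwise_word; rewrite w_eq pairwise_cat /= => /and3P[/allrelP lt1 _ /andP[/allP lt2 _]].
rewrite mem_cat inE; apply/idP/idP => [yw2|/andP[/or3P[]//]].
  by rewrite yw2 !orbT lt2.
  by move=> /lt1 /(_ (mem_head _ _)); rewrite /read_before /=; lia.
by move=> /eqP -> ; rewrite /read_before /=; lia.
Qed.

(** The letters of [w1] from y on, as a duplicate-free list with explicit membership, so that the
    balance of this suffix can be tested by comparing cardinalities. *)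
Lemma split_suffix (y : position) : y \in w -> read_before y (r, c) ->
  exists v, [/\ uniq v,
    forall z, (z \in v) = [&& z \in w, (z == y) || read_before y z & read_before z (r, c)]
    & (count (fun z => T z == i.+1) v <= count (fun z => T z != i.+1) v)%N].
Proof.
move=> yw y_lt; have yw1 : y \in w1 by rewrite split_left yw.
have := split_left; have := pairwise_word; rewrite w_eq; case: xP => _ sufP _.
case/splitPr: yw1 sufP => a b sufP; rewrite !pairwise_cat /=.
move=> /and3P[_ /and3P[/allrelP ab pa /andP[/allP yb pb]] _] leftP.
have read_irr : irreflexive read_before by move=> z; rewrite /read_before; lia.
exists (y :: b); split; last exact: sufP.
- apply: (@pairwise_uniq _ read_before) => //=; rewrite pb andbT; exact/allP.
- move=> z; rewrite andbCA -leftP inE mem_cat inE.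
  case: (eqVneq z y) => [->|zy] /=; first by rewrite orbT.
  case zb : (z \in b); first by rewrite yb // orbT.
  rewrite orbF; apply/esym/negP => /andP[yz za].
  by have := ab _ _ za (mem_head _ _); move: yz; rewrite /read_before; lia.
Qed.

Lemma split_prefix (y : position) : y \in w -> read_before (r, c) y ->
  exists v, [/\ uniq v,
    forall z, (z \in v) = [&& z \in w, (z == y) || read_before z y & read_before (r, c) z]
    & (count (fun z => T z != i.+1) v <= count (fun z => T z == i.+1) v)%N].
Proof.
move=> yw y_lt; have yw2 : y \in w2 by rewrite split_right yw.
have := split_right; have := pairwise_word; rewrite w_eq; case: xP => _ _ preP.
case/splitPr: yw2 preP => a b preP; rewrite !pairwise_cat /= !pairwise_cat /=.
move=> /and3P[_ _ /and3P[_ /allrelP ab /andP[pa /andP[/allP yb pb]]]] rightP.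
have read_irr : irreflexive read_before by move=> z; rewrite /read_before; lia.
exists (rcons a y); split; last by apply: (preP _ b); rewrite cat_rcons.
- apply: (@pairwise_uniq _ read_before) => //; rewrite pairwise_rcons pa andbT.
  by apply/allP => z za; apply: ab; rewrite ?inE ?eqxx.
- move=> z; rewrite andbCA -rightP mem_rcons mem_cat !inE.
  case: (eqVneq z y) => [->|zy] /=; first by rewrite orbT.
  case za : (z \in a); first by rewrite ab ?inE ?eqxx.
  rewrite /=; apply/esym/negP => /andP[yz zb].
  by have := yb _ zb; move: yz; rewrite /read_before; lia.
Qed.

(** If x has entry i, the row condition suffices. If it has entry i+1, an i+1 at (r, c-2) would be
    unoverlapped, since an i above it would force an i above x. The word from there to just before x
    would then consist of i+1's alone, against [no_open_suffix]. *)
Lemma split_entry_left : sq (pos r (c - 2)) -> (T (pos r (c - 2)) <= i)%N.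
Proof.
move=> yP; rewrite leqNgt; apply/negP => lt_i.
have := st_row T_tab yP split_square _; rewrite lerBlDr lerDl => /(_ isT) le_y.
have [Tx|Tx] := split_entry; first by lia.
have Ty : T (pos r (c - 2)) = i.+1 by lia.
have yw : (pos r (c - 2)) \in w.
  rewrite mem_word yP Ty eqxx orbT /=; apply: contra split_not_overlap => ov.
  have [r' [Er r'P r'i]] := overlap_above yP Ty ov.
  have r'c : sq (r', c).
    by apply: (square_above _ _ _ _ r'P split_square) => //;
      rewrite ?Er /= ?negbK //; lia.
  have le_r' : (T (pos r' (c - 2)) <= T (pos r' c))%N by apply: (st_row T_tab) => //; lia.
  have lt_r' : (T (pos r' c) < T (pos r c))%N.
    by apply: (st_col T_tab) => //; [exact: split_square | lia].
  by rewrite Er; apply: in_overlap_lower; rewrite -?Er ?split_square //; lia.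
have [|v [v_uniq vP]] := split_suffix yw; first by rewrite /read_before /=; lia.
apply/negP; rewrite -ltnNge; apply: (@leq_trans 1%N).
  rewrite ltnS; apply: (@count_le_size _ _ _ [::]) => // -[r' c'].
  rewrite vP mem_word xpair_eqE /read_before /= => /and3P[/and3P[zP Tz' _] z1 z2] Tz.
  have Er : r' = r by clear -z1 z2; lia.
  subst r'; have yz : c - 2 <= c' by clear -z1 z2; lia.
  have := st_row T_tab yP zP yz; rewrite Ty; move: Tz Tz'; clear; lia.
apply: (@size_le_count _ _ _ [:: pos r (c - 2)]) => // z; rewrite inE => /eqP ->.
by rewrite vP yw eqxx Ty eqxx /read_before /=; clear; lia.
Qed.

Lemma split_entry_right : sq (pos r (c + 2)) -> (i < T (pos r (c + 2)))%N.
Proof.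
move=> yP; rewrite ltnNge; apply/negP => le_i.
have := st_row T_tab split_square yP _; rewrite lerDl => /(_ isT) le_y.
have [Tx|Tx] := split_entry; last by lia.
have Ty : T (pos r (c + 2)) = i by lia.
have yw : (pos r (c + 2)) \in w.
  rewrite mem_word yP Ty eqxx /=; apply: contra split_not_overlap.
  rewrite !overlap_below ?split_square // => /andP[r2P /eqP T2].
  have r2c : sq (r.+2, c).
    by apply: (square_below _ _ _ _ split_square r2P) => //;
      rewrite ?negbK //=; lia.
  have := st_row T_tab r2c r2P _; rewrite lerDl => /(_ isT) le_r2.
  have := st_col T_tab split_square r2c (leqnSn _).
  by rewrite r2c eqn_leq; lia.
have [|v [v_uniq vP]] := split_prefix yw; first by rewrite /read_before /=; lia.
apply/negP; rewrite -ltnNge; apply: (@leq_trans 1%N).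
  rewrite ltnS; apply: (@count_le_size _ _ _ [::]) => // -[r' c'].
  rewrite vP mem_word xpair_eqE /read_before /= => /and3P[/and3P[zP _ _] z1 z2] Tz.
  have Er : r' = r by clear -z1 z2; lia.
  subst r'; have yz : c' <= c + 2 by clear -z1 z2; lia.
  by have := st_row T_tab zP yP yz; lia.
apply: (@size_le_count _ _ _ [:: pos r (c + 2)]) => // z; rewrite inE => /eqP ->.
by rewrite vP yw eqxx Ty /read_before /=; clear; lia.
Qed.

(* Pigeonhole: in the suffix starting at the leftmost of the l given i+1's, all
   letters i lie in row r to the left of c, and there are at least l of them. *)
Lemma split_run_left (l : nat) :
  (forall k, (0 < k <= l)%N ->
     pos r.+1 (c + 1 - 2 * k%:Z) \in w /\ T (pos r.+1 (c + 1 - 2 * k%:Z)) = i.+1) ->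
  forall k, (0 < k <= l)%N ->
    pos r (c - 2 * k%:Z) \in w /\ T (pos r (c - 2 * k%:Z)) = i.
Proof.
move=> runP.
have [->|l_gt0] := posnP l; first by move=> k; lia.
have [|yw Ty] := runP l; first by rewrite l_gt0 leqnn.
have [|v [v_uniq vP vle]] := split_suffix yw; first by rewrite /read_before /= ltnSn.
(* The l-1 positions of row r strictly between columns c - 2l and c. The suffix has at least l
   letters i, so one of them is outside [L]; it turns out to lie in row r, at column c - 2l or
   further left. *)
pose L := [seq pos r (c - 2 * k%:Z) | k <- iota 1 l.-1].
have [[r' c'] zv] : exists2 z, z \in v & ~~ ((T z != i.+1) ==> (z \in L)).
  apply/allPn/negP => /allP vL; move: vle; apply/negP; rewrite -ltnNge.
  apply: (@leq_ltn_trans (size L)).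
    by apply: count_le_size => // z /vL /implyP.
  rewrite size_map size_iota prednK //.
  rewrite -[X in (X <= _)%N](_ : size [seq pos r.+1 (c + 1 - 2 * k%:Z) | k <- iota 1 l] = l).
    apply: size_le_count.
      by rewrite map_inj_uniq ?iota_uniq // => k k' [] /eqP; clear; lia.
    move=> z /mapP[k]; rewrite mem_iota => kP ->; have [|kw Tk] := runP k.
      by move: kP; clear; lia.
    rewrite vP kw Tk eqxx /read_before xpair_eqE /= andbT.
    by move: kP; clear; lia.
  by rewrite size_map size_iota.
rewrite vP negb_imply mem_word /read_before xpair_eqE /= in zv *.
case/andP=> Tz zL; move: zv => /and3P[/and3P[zP Tz' z_ov] z1 z2].
have Tzi : T (pos r' c') = i by move: Tz Tz'; clear; lia.
have Er : r' = r.
  suff : r' != r.+1 by move: z1 z2; clear; lia.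
  apply: contraNneq Tz => Er; subst r'; rewrite eqn_leq {1}Tzi leqnSn /=.
  have yP : sq (pos r.+1 (c + 1 - 2 * l%:Z)) by move: yw; rewrite mem_word => /andP[].
  have := st_row T_tab yP zP _; rewrite Ty; apply; move: z1; clear; lia.
subst r'; have far : c' <= c - 2 * l%:Z.
  have := split_square => /squareP[_ + _ _]; move: (zP) => /squareP[_ + _ _].
  rewrite /same_parity leNgt => c'p cp; apply: contra zL => c'l; apply/mapP.
  exists `|((c - c') %/ 2)%Z|%N.
    by rewrite mem_iota; move: z2 c'l c'p cp; clear -l_gt0; lia.
  by congr pair; move: z2 c'l c'p cp; clear; lia.
move=> k kP; have cP := split_square.
have par_k : same_parity r (c - 2 * k%:Z).
  by rewrite same_parity_sub; case/squareP: cP.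
have kc : c' <= c - 2 * k%:Z by move: far kP; clear; lia.
have kS : sq (pos r (c - 2 * k%:Z)).
  by apply: (square_in_row zP cP par_k); rewrite kc; move: kP; clear; lia.
(* Row r increases from the i at column c' to an entry at most i at column c - 2, so it is
   constantly i in between. *)
have Tk : T (pos r (c - 2 * k%:Z)) = i.
  apply/eqP; rewrite eqn_leq -{2}Tzi (st_row T_tab zP kS kc) andbT.
  have c2P : sq (pos r (c - 2)).
    apply: (square_in_row kS cP); last by move: kP; clear; lia.
    by rewrite (same_parity_sub r c 1); case/squareP: cP.
  apply: leq_trans (split_entry_left c2P).
  by apply: (st_row T_tab) => //; move: kP; clear; lia.
(* An i+1 below (r, c-2k) would force one below the i at (r, c'), because row r+2 is weakly
   increasing and columns are strict; but that i is a letter of the word. *)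
split=> //; rewrite mem_word kS Tk eqxx /= overlap_below //; apply/negP.
case/andP=> k2P /eqP T2.
have z2P : sq (pos r.+2 c').
  exact: (square_below _ _ _ _ zP k2P (leqW (leqnSn r)) (esym (negbK _)) kc).
move: z_ov; rewrite overlap_below // z2P eqn_leq.
have := st_row T_tab z2P k2P kc; have := st_col T_tab zP z2P (leqnSn _).
by rewrite T2 Tzi => -> ->.
Qed.

(** Half-turn of [split_run_left], exchanging i and i+1: the pigeonhole is applied to the prefix of
    [w2] ending at the rightmost given i, whose letters i+1 all lie in row r to the right of c. *)
Lemma split_run_right (r0 l : nat) : r = r0.+1 ->
  (forall k, (0 < k <= l)%N ->
     pos r0 (c - 1 + 2 * k%:Z) \in w /\ T (pos r0 (c - 1 + 2 * k%:Z)) = i) ->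
  forall k, (0 < k <= l)%N ->
    pos r (c + 2 * k%:Z) \in w /\ T (pos r (c + 2 * k%:Z)) = i.+1.
Proof.
move=> Er0 runP.
have [->|l_gt0] := posnP l; first by move=> k; lia.
have [|yw Ty] := runP l; first by rewrite l_gt0 leqnn.
have [|v [v_uniq vP vle]] := split_prefix yw; first by rewrite /read_before /= Er0 ltnSn.
pose L := [seq pos r (c + 2 * k%:Z) | k <- iota 1 l.-1].
have [[r' c'] zv] : exists2 z, z \in v & ~~ ((T z == i.+1) ==> (z \in L)).
  apply/allPn/negP => /allP vL; move: vle; apply/negP; rewrite -ltnNge.
  apply: (@leq_ltn_trans (size L)).
    by apply: count_le_size => // z /vL /implyP.
  rewrite size_map size_iota prednK //.
  rewrite -[X in (X <= _)%N](_ : size [seq pos r0 (c - 1 + 2 * k%:Z) | k <- iota 1 l] = l).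
    apply: size_le_count.
      by rewrite map_inj_uniq ?iota_uniq // => k k' [] /eqP; clear; lia.
    move=> z /mapP[k]; rewrite mem_iota => kP ->; have [|kw Tk] := runP k.
      by move: kP; clear; lia.
    rewrite vP kw Tk eqn_leq ltnn andbF /read_before xpair_eqE /= andbT Er0.
    by move: kP; clear; lia.
  by rewrite size_map size_iota.
rewrite vP negb_imply mem_word /read_before xpair_eqE /= in zv *.
case/andP=> /eqP Tz zL; move: zv => /and3P[/and3P[zP _ z_ov] z1 z2].
have Er : r' = r.
  suff : r' != r0 by move: z1 z2 Er0; clear; lia.
  apply/eqP => Er; subst r'.
  have yP : sq (pos r0 (c - 1 + 2 * l%:Z)) by move: yw; rewrite mem_word => /andP[].
  have := st_row T_tab zP yP _; rewrite Ty Tz ltnn => H.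
  by have /H : c' <= c - 1 + 2 * l%:Z by move: z1; clear; lia.
subst r'; have far : c + 2 * l%:Z <= c'.
  have := split_square => /squareP[_ + _ _]; move: (zP) => /squareP[_ + _ _].
  rewrite /same_parity leNgt => c'p cp; apply: contra zL => c'l; apply/mapP.
  exists `|((c' - c) %/ 2)%Z|%N.
    by rewrite mem_iota; move: z2 c'l c'p cp; clear -l_gt0; lia.
  by congr pair; move: z2 c'l c'p cp; clear; lia.
move=> k kP; have cP := split_square.
have par_k : same_parity r (c + 2 * k%:Z).
  by rewrite -(same_parity_sub r _ k) addrK; case/squareP: cP.
have kc : c + 2 * k%:Z <= c' by move: far kP; clear; lia.
have kS : sq (pos r (c + 2 * k%:Z)).
  by apply: (square_in_row cP zP par_k); rewrite kc andbT; clear; lia.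
have Tk : T (pos r (c + 2 * k%:Z)) = i.+1.
  apply/eqP; rewrite eqn_leq -{1}Tz (st_row T_tab kS zP kc) /=.
  have c2P : sq (pos r (c + 2)).
    apply: (square_in_row cP kS); last by move: kP; clear; lia.
    by rewrite -(same_parity_sub r _ 1) addrK; case/squareP: cP.
  apply: leq_trans (split_entry_right c2P) _.
  by apply: (st_row T_tab) => //; move: kP; clear; lia.
split=> //; rewrite mem_word kS Tk eqxx orbT /=; apply/negP.
move=> /(overlap_above kS Tk)[r2 [Er2 k2P T2]].
have z2P : sq (pos r2 c').
  rewrite Er2 in zP.
  exact: (square_above _ _ _ _ k2P zP (leqW (leqnSn r2)) (esym (negbK _)) kc).
move: z_ov; apply/negP; rewrite negbK Er2.
have lt2 : (T (pos r2 c') < T (pos r c'))%N by apply: (st_col T_tab) => //; rewrite Er2.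
have le2 := st_row T_tab k2P z2P kc.
by apply: in_overlap_lower; rewrite -?Er2 //; move: lt2 le2; rewrite T2 Tz; clear; lia.
Qed.

End ReadingOrder.

(** * Flipping a crossing on a loop *)

(** [f] and [g] complete [e] by the two smoothings of one crossing, s1-s2 with u-v and s1-u with
    s2-v. As s1 and s2 are already joined in [e], an edge s1-s2 of [f] only closes a loop, whereas
    [g] inserts that loop into the connection from u to v. *)
Lemma connect_smoothing (V : finType) (e f g : rel V) (s1 s2 u v x y : V) :
  symmetric e -> symmetric f -> symmetric g -> subrel e f -> subrel e g ->
  f u v -> g s1 u -> g s2 v ->
  (forall a b, f a b -> e a b \/
     (a, b) \in [:: (s1, s2); (s2, s1); (u, v); (v, u)]) ->
  (forall a b, g a b -> e a b \/
     (a, b) \in [:: (s1, u); (u, s1); (s2, v); (v, s2)]) ->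
  connect e s1 s2 -> ~~ connect e s1 x -> ~~ connect e s1 y ->
  connect f x y = connect g x y.
Proof.
move=> es fs gs ef eg fuv gs1u gs2v fE gE es12 ex ey.
have esym := sym_connect_sym es; have fsym := sym_connect_sym fs.
have gsym := sym_connect_sym gs.
have sub_eg a b : connect e a b -> connect g a b.
  by apply: connect_sub => c d /eg/connect1.
have g12 := sub_eg _ _ es12.
have guv : connect g u v.
  apply: connect_trans (connect_trans _ g12) (connect1 gs2v).
  by rewrite gsym; apply: connect1.
apply/idP/idP.
  apply: connect_sub => a b /fE[/eg/connect1 //|].
  by rewrite !inE => /or4P[] /eqP[-> ->] //; rewrite gsym.
(* The component of s1 in e is an arc of g from u to v: retract it onto u. *)
pose h a := if connect e s1 a then u else a.
have homo_h a b : connect g a b -> connect f (h a) (h b).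
  move=> /connectP[p]; elim: p a => [|c p IHp] a /=; first by move=> _ ->.
  case/andP=> gac pP def_b; apply: connect_trans (IHp _ pP def_b).
  have hu : h u = u by rewrite /h; case: ifP.
  have hs1 : h s1 = u by rewrite /h connect0.
  have hs2 : h s2 = u by rewrite /h es12.
  have uhv : connect f u (h v) by rewrite /h; case: ifP => // _; apply: connect1.
  case: (gE _ _ gac) => [eac|].
    rewrite /h; have -> : connect e s1 a = connect e s1 c.
      by rewrite !(esym s1); apply: same_connect; rewrite ?connect1.
    by case: ifP => // _; apply/connect1/ef.
  by rewrite !inE => /or4P[] /eqP[-> ->]; rewrite ?hu ?hs1 ?hs2 // fsym.
by move=> /homo_h; rewrite /h (negbTE ex) (negbTE ey).
Qed.

Section Diagram.

Local Open Scope ring_scope.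

Variables (n : nat) (mu nu : n.-tuple nat).
Hypotheses (mu_part : is_partition mu) (nu_part : is_partition nu).

Local Notation vertex := (seq_sub (vertices mu nu)).

(** [arrow] for an arbitrary set of uncrossed positions, since the set reached between the two flips
    need not come from a filling. *)
Definition arrow_of (U : nat -> int -> bool) (x y : position) : bool :=
  let: (r, c) := x in
     [&& y == (r, c + 1), ~~ U r (c + 1) & ~~ U r.-1 (c + 1)]
  || (y == (r.+1, c)) && (U r c || U r (c + 1)).

Definition edge_of (U : nat -> int -> bool) : rel vertex :=
  fun x y => arrow_of U (val x) (val y) || arrow_of U (val y) (val x).

Definition joined_of (U : nat -> int -> bool) (a b : endpoint n) : bool :=
  [exists x : vertex, exists y : vertex,
    [&& val x == endpoint_pos mu nu a, val y == endpoint_pos mu nu b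
      & connect (edge_of U) x y]].

Definition admissible (U : nat -> int -> bool) : Prop :=
  forall r c, U r c -> [&& (1 <= r < n)%N, same_parity r c
                         & row_start nu r <= c <= row_end mu r.+1 + 1].

Lemma edge_of_sym (U : nat -> int -> bool) : symmetric (edge_of U).
Proof. by move=> x y; rewrite /edge_of orbC. Qed.

(* The smoothings at (a, p) and (a, q), together with the horizontal edges of
   rows a and a+1 in between, close up to a loop on the columns p to q-1. *)
Record loop (U : nat -> int -> bool) (a : nat) (p q : int) : Prop := Loop {
  loop_lt : p < q;
  loop_left : U a p;
  loop_right : U a q;
  loop_empty : forall t, p < t < q -> [/\ ~~ U a.-1 t, ~~ U a t & ~~ U a.+1 t] }.

Definition in_loop (a : nat) (p q : int) (x : position) : bool :=
  ((x.1 == a) || (x.1 == a.+1)) && (p <= x.2 < q).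

(** The horizontal exits are cut at p and q. A vertical exit would need an uncrossed position of row
    a-1 or a+1 in a column from p to q: strictly in between [loop_empty] excludes it, and at p and q
    parity does. *)
Lemma loop_closed (U : nat -> int -> bool) (a : nat) (p q : int) (x y : vertex) :
  admissible U -> loop U a p q -> edge_of U x y ->
  in_loop a p q (val x) -> in_loop a p q (val y).
Proof.
move=> Uadm [pq Up Uq Uin]; rewrite /edge_of /in_loop.
case: (val x) => r c; case: (val y) => r' c' /= xy /andP[ra cpq].
have noU t s : (t == a.-1) || (t == a.+1) -> p <= s <= q -> ~~ U t s.
  move=> ta sP; apply/negP => Uts; have /and3P[_ par_s _] := Uadm _ _ Uts.
  have /and3P[/andP[a1 _] par_p _] := Uadm _ _ Up.
  have /and3P[_ par_q _] := Uadm _ _ Uq.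
  have par_a : ~~ same_parity a s.
    case/orP: ta par_s => /eqP->; last by rewrite same_parityS.
    by rewrite -{2}(prednK a1) same_parityS negbK.
  have sp : s <> p by move=> Es; rewrite Es par_p in par_a.
  have sq : s <> q by move=> Es; rewrite Es par_q in par_a.
  have [|] := Uin s; first by clear -sP sp sq; lia.
  by case/orP: ta Uts => /eqP-> ->.
case/orP: xy => /orP[].
- case/and3P => /eqP[-> ->] Uc Uc1; rewrite ra /=.
  suff : c + 1 <> q by lia.
  by move=> Eq; move: Uc Uc1; rewrite Eq; case/orP: ra => /eqP-> /=; rewrite Uq.
- case/andP => /eqP[-> ->]; rewrite cpq andbT; case/orP: ra => /eqP -> //.
    by rewrite eqxx orbT.
  by rewrite !(negbTE (noU _ _ _ _)) ?eqxx ?orbT //; lia.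
- case/and3P => /eqP[Er Ec] Uc Uc1; subst r c; rewrite ra /=.
  suff : c' + 1 <> p by lia.
  by move=> Ep; move: Uc Uc1; rewrite Ep; case/orP: ra => /eqP-> /=; rewrite Up.
case/andP => /eqP[Er Ec]; subst r c; rewrite cpq andbT.
case/orP: ra => [/eqP ra|]; last by rewrite eqSS => ->.
have r'a : r' = a.-1 by rewrite -ra.
by rewrite !(negbTE (noU _ _ _ _)) ?r'a ?eqxx //; lia.
Qed.

(** The smoothings at p and q also have corners in columns p - 1 and q, outside the loop but still
    vertices, so the loop stays strictly between the endpoint columns. *)
Lemma loop_bounds (U : nat -> int -> bool) (a r : nat) (p q c : int) :
  admissible U -> loop U a p q -> in_loop a p q (r, c) ->
  (1 <= r <= n)%N /\ left_col nu r < c < right_col mu r.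
Proof.
move=> Uadm [pq /Uadm/and3P[an _ pb] /Uadm/and3P[_ _ qb] _].
have [] := corners_in_vertices mu_part nu_part an pb.
have [] := corners_in_vertices mu_part nu_part an qb.
by move=> ? ? ? ? ? ? ? ? /andP[/orP[]/eqP /= ->]; lia.
Qed.

Lemma endpoint_notin_loop (U : nat -> int -> bool) (a : nat) (p q : int)
    (b : endpoint n) :
  admissible U -> loop U a p q -> ~~ in_loop a p q (endpoint_pos mu nu b).
Proof.
by move=> Uadm Uloop; apply/negP; case: b => r /(loop_bounds Uadm Uloop) []; lia.
Qed.

Lemma row_connect (e : rel vertex) (r : nat) (s t : int) (x y : vertex) :
  s <= t -> val x = (r, s) -> val y = (r, t) ->
  (forall (z z' : vertex) c, s <= c < t -> val z = (r, c) -> val z' = (r, c + 1) ->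
    e z z') ->
  connect e x y.
Proof.
move=> st Ex; have [k ->] : exists k : nat, t = s + k%:Z.
  by exists `|t - s|%N; lia.
elim: k y {st t} => [|k IHk] y Ey e_row.
  by rewrite (_ : x = y) ?connect0 //; apply: val_inj; rewrite Ex Ey addr0.
have z_in : (r, s + k%:Z) \in vertices mu nu.
  have := valP x; have := valP y; rewrite Ex Ey !mem_vertices; lia.
apply: (@connect_trans _ _ (SeqSub z_in)); last apply: connect1.
  by apply: IHk => // z z' c cP; apply: e_row; lia.
by apply: (e_row _ _ (s + k%:Z)) => //; [lia | rewrite Ey; congr pair; lia].
Qed.

(** * The two smoothings of a single crossing *)

Section Toggle.

Variables (U U' : nat -> int -> bool) (r0 : nat) (c0 : int).
Hypotheses (Uoff : ~~ U r0 c0) (Uon : U' r0 c0) (U'adm : admissible U').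
Hypothesis Uagree : forall r c, (r, c) != (r0, c0) -> U r c = U' r c.

(** Corners of the flipped crossing, A and B on top, C and D at the bottom: [U] has the edges AB and
    CD, [U'] has AC and BD. *)
Let cA : position := (r0, c0 - 1).
Let cB : position := (r0, c0).
Let cC : position := (r0.+1, c0 - 1).
Let cD : position := (r0.+1, c0).

Lemma toggle_sub (r : nat) (c : int) : U r c -> U' r c.
Proof.
by case: (eqVneq (r, c) (r0, c0)) => [[-> ->]|/Uagree ->].
Qed.

Lemma toggle_admissible : admissible U.
Proof. by move=> r c /toggle_sub /U'adm. Qed.

Lemma arrow_of_on (x y : position) : arrow_of U x y ->
  arrow_of U' x y \/ (x, y) \in [:: (cA, cB); (cC, cD)].
Proof.
case: x => r c /=; have /and3P[/andP[r0_gt0 _] _ _] := U'adm Uon.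
case/orP => [/and3P[/eqP -> Uc Uc1]|/andP[-> Uc]]; last first.
  by left; case/orP: Uc => /toggle_sub -> /=; rewrite !orbT.
rewrite !inE !xpair_eqE eqxx /= /cA /cB.
case: (eqVneq (r, c + 1) (r0, c0)) => [[-> <-]|ne].
  by right; rewrite addrK !eqxx.
case: (eqVneq (r.-1, c + 1) (r0, c0)) => [[Er <-]|ne1].
  by right; rewrite addrK -Er prednK ?eqxx ?orbT //; case: (r) Er r0_gt0 => //= <-.
by left; rewrite -(Uagree ne) -(Uagree ne1) Uc Uc1 !eqxx.
Qed.

Lemma arrow_of_off (x y : position) : arrow_of U' x y ->
  arrow_of U x y \/ (x, y) \in [:: (cA, cC); (cB, cD)].
Proof.
case: x => r c /=.
case/orP => [/and3P[/eqP -> Uc Uc1]|/andP[/eqP-> Uc]].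
  by left; rewrite eqxx !(contra (@toggle_sub _ _)).
rewrite !inE !xpair_eqE !eqxx /= /cA /cC.
case: (eqVneq (r, c) (r0, c0)) => [[-> ->]|ne]; first by right; rewrite !eqxx orbT.
case: (eqVneq (r, c + 1) (r0, c0)) => [[-> <-]|ne1]; first by right; rewrite addrK !eqxx.
by left; rewrite (Uagree ne) (Uagree ne1) Uc orbT.
Qed.

(** By parity nothing is uncrossed at column c0 in rows r0 - 1 and r0 + 1, so only (r0, c0) can cut
    the horizontal edges AB and CD. *)
Lemma arrow_of_corners :
  [/\ arrow_of U cA cB, arrow_of U cC cD, arrow_of U' cA cC & arrow_of U' cB cD].
Proof.
have /and3P[/andP[r0_gt0 _] par0 _] := U'adm Uon.
have Upar r : U r c0 -> same_parity r c0 by move=> /toggle_sub/U'adm/and3P[].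
rewrite /= !subrK !eqxx Uoff Uon /= !orbT; split=> //; apply/orP; left.
  apply/negP => /Upar; move: par0; rewrite -{1}(prednK r0_gt0) same_parityS.
  by case: same_parity.
by rewrite andbT; apply/negP => /Upar; rewrite same_parityS par0.
Qed.

Let e : rel vertex := fun x y => edge_of U x y && edge_of U' x y.

Lemma toggle_edge_sym : symmetric e.
Proof. by move=> x y; rewrite /e !(edge_of_sym _ x). Qed.

(** [V] is whichever of [U] and [U'] carries the loop, and s1-s2 is the edge of the loop at the
    flipped crossing. The rest of the loop is common to both graphs and joins s1 to s2. As the loop
    is closed in [V], the component of s1 in [e] contains no endpoint, and [connect_smoothing]
    applies. *)
Lemma joined_of_toggle (V : nat -> int -> bool) (a : nat) (p q : int)
    (s1 s2 : vertex) (b b' : endpoint n) :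
  connect e s1 s2 -> loop V a p q -> in_loop a p q (val s1) ->
  V = U /\ (val s1, val s2) \in [:: (cA, cB); (cC, cD)] \/
  V = U' /\ (val s1, val s2) \in [:: (cA, cC); (cB, cD)] ->
  joined_of U b b' = joined_of U' b b'.
Proof.
move=> es12 Vloop s1_in sP; rewrite /joined_of.
have Vadm : admissible V by case: sP => -[-> _] //; exact: toggle_admissible.
have eV : subrel e (edge_of V).
  by move=> x y /andP[]; case: sP => -[-> _].
have es1 (x : vertex) b0 : val x = endpoint_pos mu nu b0 -> ~~ connect e s1 x.
  move=> Ex; apply: contra (endpoint_notin_loop b0 Vadm Vloop) => s1x.
  suff : closed e [pred z : vertex | in_loop a p q (val z)].
    by move=> /closed_connect/(_ _ _ s1x); rewrite !inE s1_in -Ex => <-.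
  apply: intro_closed; first exact: sym_connect_sym toggle_edge_sym.
  by move=> z z' /eV zz'; apply: loop_closed zz'.
suff connE x y : ~~ connect e s1 x -> ~~ connect e s1 y ->
    connect (edge_of U) x y = connect (edge_of U') x y.
  apply: eq_existsb => x; apply: eq_existsb => y.
  case: eqP => //= /es1 s1x; case: eqP => //= /es1 s1y; exact: connE.
have /and3P[rn _ cb] := U'adm Uon.
have [cb1 cb2 cb3 cb4] := corners_in_vertices mu_part nu_part rn cb.
have inA : cA \in vertices mu nu.
  by rewrite mem_vertices; clear -rn cb1 cb2 cb3 cb4; lia.
have inB : cB \in vertices mu nu.
  by rewrite mem_vertices; clear -rn cb1 cb2 cb3 cb4; lia.
have inC : cC \in vertices mu nu.
  by rewrite mem_vertices; clear -rn cb1 cb2 cb3 cb4; lia.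
have inD : cD \in vertices mu nu.
  by rewrite mem_vertices; clear -rn cb1 cb2 cb3 cb4; lia.
pose A : vertex := SeqSub inA; pose B : vertex := SeqSub inB.
pose C : vertex := SeqSub inC; pose D : vertex := SeqSub inD.
have [UAB UCD UAC UBD] := arrow_of_corners.
have toE (z z' : vertex) L : (val z, val z') \in [seq (val w.1, val w.2) | w <- L] ->
    (z, z') \in L.
  by move=> /mapP[[w w'] wL [/val_inj-> /val_inj->]].
have onP (z z' : vertex) : edge_of U z z' ->
    e z z' \/ (z, z') \in [:: (A, B); (B, A); (C, D); (D, C)].
  move=> zz'; rewrite /e zz' /edge_of /=; case/orP: zz' => /arrow_of_on[->|zin];
    rewrite ?orbT; [by left| right | by left | right]; apply: toE; move: zin;
    rewrite !inE !xpair_eqE => /orP[] /andP[-> ->]; rewrite ?orbT //.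
have offP (z z' : vertex) : edge_of U' z z' ->
    e z z' \/ (z, z') \in [:: (A, C); (C, A); (B, D); (D, B)].
  move=> zz'; rewrite /e zz' andbT /edge_of /=; case/orP: zz' => /arrow_of_off[->|zin];
    rewrite ?orbT; [by left| right | by left | right]; apply: toE; move: zin;
    rewrite !inE !xpair_eqE => /orP[] /andP[-> ->]; rewrite ?orbT //.
have eU : subrel e (edge_of U) by move=> z z' /andP[].
have eU' : subrel e (edge_of U') by move=> z z' /andP[].
have [Us U's] := (edge_of_sym U, edge_of_sym U').
have eAB : edge_of U A B by rewrite /edge_of UAB.
have eCD : edge_of U C D by rewrite /edge_of UCD.
have eAC : edge_of U' A C by rewrite /edge_of UAC.
have eBD : edge_of U' B D by rewrite /edge_of UBD.
have [eBA eDC eCA eDB] : [/\ edge_of U B A, edge_of U D C, edge_of U' C A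
    & edge_of U' D B] by split; rewrite edge_of_sym.
have atE (z : vertex) w (wV : w \in vertices mu nu) : val z == w -> z = SeqSub wV.
  by move=> /eqP Ez; apply: val_inj.
have smooth := @connect_smoothing _ e _ _ _ _ _ _ x y toggle_edge_sym.
have reorder z z' (w1 w2 w3 w4 : vertex * vertex) (L : seq (vertex * vertex)) :
    [&& w1 \in L, w2 \in L, w3 \in L & w4 \in L] ->
    e z z' \/ (z, z') \in [:: w1; w2; w3; w4] -> e z z' \/ (z, z') \in L.
  move=> /and4P[? ? ? ?] []; first by left.
  by rewrite !inE => /or4P[] /eqP->; right.
(* The loop meets the crossing from above (AB), below (CD), left (AC) or right (BD); in the last two
   cases it belongs to [U'], and [U] and [U'] exchange roles. *)
case: sP => -[_]; rewrite !inE !xpair_eqE => /orP[] /andP[].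
- move=> /(atE _ _ inA) E1 /(atE _ _ inB) E2; rewrite {}E1 {}E2 in es12 *.
  exact: (smooth _ _ A B C D).
- move=> /(atE _ _ inC) E1 /(atE _ _ inD) E2; rewrite {}E1 {}E2 in es12 *.
  apply: (smooth _ _ C D A B) => // z z'.
    by move=> /onP; apply: reorder; rewrite !inE !eqxx ?orbT.
  by move=> /offP; apply: reorder; rewrite !inE !eqxx ?orbT.
- move=> /(atE _ _ inA) E1 /(atE _ _ inC) E2; rewrite {}E1 {}E2 in es12 *.
  by move=> s1x s1y; apply/esym/(smooth _ _ A C B D).
move=> /(atE _ _ inB) E1 /(atE _ _ inD) E2; rewrite {}E1 {}E2 in es12 *.
move=> s1x s1y; apply/esym/(smooth _ _ B D A C) => // z z'.
  by move=> /offP; apply: reorder; rewrite !inE !eqxx ?orbT.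
by move=> /onP; apply: reorder; rewrite !inE !eqxx ?orbT.
Qed.

End Toggle.

Lemma loop_vertex (U : nat -> int -> bool) (a : nat) (p q : int) (x : position) :
  admissible U -> loop U a p q -> in_loop a p q x -> x \in vertices mu nu.
Proof.
case: x => r c Uadm Uloop /(loop_bounds Uadm Uloop)[rn cb].
by rewrite mem_vertices rn /=; clear -cb; lia.
Qed.

Lemma loop_row (U : nat -> int -> bool) (a r : nat) (p q c : int) :
  loop U a p q -> (r == a) || (r == a.+1) -> p <= c -> c + 1 < q ->
  arrow_of U (r, c) (r, c + 1).
Proof.
move=> [_ _ _ Uin] ra pc cq; have [|U1 U2 U3] := Uin (c + 1).
  by apply/andP; split=> //; clear -pc; lia.
by rewrite /= eqxx; case/orP: ra => /eqP ->; rewrite /= ?U1 ?U2 ?U3.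
Qed.

Lemma arrow_of_horizontal (U U' : nat -> int -> bool) (r : nat) (c : int) :
  (forall t s, U t s -> U' t s) ->
  arrow_of U' (r, c) (r, c + 1) -> arrow_of U (r, c) (r, c + 1).
Proof.
move=> UU' /=; rewrite eqxx (_ : ((r, c + 1) == (r.+1, c)) = false).
  by rewrite !orbF /= => /andP[/(contra (UU' _ _)) -> /(contra (UU' _ _)) ->].
by apply/negP => /eqP[]; lia.
Qed.

Lemma arrow_of_down (U : nat -> int -> bool) (r : nat) (c : int) :
  U r c -> arrow_of U (r, c) (r.+1, c) /\ arrow_of U (r, c - 1) (r.+1, c - 1).
Proof. by move=> Urc; rewrite /= !subrK Urc !eqxx !orbT. Qed.

(** * Flips at an end of a loop, and above or below a loop *)

Section LoopToggle.

Variables (U U' : nat -> int -> bool) (r0 : nat) (c0 : int).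
Hypotheses (Uoff : ~~ U r0 c0) (Uon : U' r0 c0) (U'adm : admissible U').
Hypothesis Uagree : forall r c, (r, c) != (r0, c0) -> U r c = U' r c.

Let UU' := toggle_sub Uon Uagree.
Let Uadm := toggle_admissible Uon U'adm Uagree.
Let e : rel vertex := fun x y => edge_of U x y && edge_of U' x y.
Let e_sym : connect_sym e := sym_connect_sym (toggle_edge_sym U U').

Lemma toggle_connect1 (x y : vertex) :
  arrow_of U (val x) (val y) -> arrow_of U' (val x) (val y) -> connect e x y.
Proof. by move=> Uxy U'xy; apply: connect1; rewrite /e /edge_of Uxy U'xy. Qed.

(** The flipped crossing is the right end of the loop. The common part of the loop runs from (r0,
    c0-1) left along row r0, down at column p, and back along row r0 + 1. *)
Lemma joined_of_toggle_right (p : int) (b b' : endpoint n) :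
  loop U' r0 p c0 -> joined_of U b b' = joined_of U' b b'.
Proof.
move=> Uloop; have [pq Up _ _] := Uloop.
have inV x : in_loop r0 p c0 x -> x \in vertices mu nu by exact: loop_vertex Uloop.
have in1 : in_loop r0 p c0 (r0, c0 - 1) by rewrite /in_loop /= eqxx /=; clear -pq; lia.
have in2 : in_loop r0 p c0 (r0.+1, c0 - 1).
  by rewrite /in_loop /= eqxx orbT; clear -pq; lia.
have in3 : in_loop r0 p c0 (r0, p) by rewrite /in_loop /= eqxx lexx pq.
have in4 : in_loop r0 p c0 (r0.+1, p) by rewrite /in_loop /= eqxx orbT lexx pq.
apply: (joined_of_toggle (V := U') (s1 := SeqSub (inV _ in1))
  (s2 := SeqSub (inV _ in2)) Uoff Uon U'adm Uagree _ _ _ Uloop) => //; last first.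
  by right; split=> //=; rewrite inE eqxx.
have rowP r : (r == r0) || (r == r0.+1) -> forall (z z' : vertex) c,
    p <= c < c0 - 1 -> val z = (r, c) -> val z' = (r, c + 1) -> e z z'.
  move=> rP z z' c /andP[pc cq] Ez Ez'.
  have cq' : c + 1 < c0 by clear -cq; lia.
  have := loop_row Uloop rP pc cq'; rewrite /e /edge_of Ez Ez'.
  by move=> /[dup] /(arrow_of_horizontal UU') -> ->.
have pq1 : p <= c0 - 1 by clear -pq; lia.
apply: (connect_trans (y := SeqSub (inV _ in3))).
  by rewrite e_sym; apply: (row_connect pq1) (rowP r0 _); rewrite ?eqxx.
apply: (connect_trans (y := SeqSub (inV _ in4))); last first.
  by apply: (row_connect pq1) (rowP r0.+1 _); rewrite ?eqxx ?orbT.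
have U1p : U r0 p by rewrite Uagree // xpair_eqE eqxx lt_eqF.
by apply: toggle_connect1; have [] := arrow_of_down Up;
  have [] := arrow_of_down U1p.
Qed.

Lemma joined_of_toggle_left (q : int) (b b' : endpoint n) :
  loop U' r0 c0 q -> joined_of U b b' = joined_of U' b b'.
Proof.
move=> Uloop; have [pq _ Uq _] := Uloop.
have inV x : in_loop r0 c0 q x -> x \in vertices mu nu by exact: loop_vertex Uloop.
have in1 : in_loop r0 c0 q (r0, c0) by rewrite /in_loop /= eqxx lexx pq.
have in2 : in_loop r0 c0 q (r0.+1, c0) by rewrite /in_loop /= eqxx orbT lexx pq.
have in3 : in_loop r0 c0 q (r0, q - 1) by rewrite /in_loop /= eqxx /=; clear -pq; lia.
have in4 : in_loop r0 c0 q (r0.+1, q - 1).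
  by rewrite /in_loop /= eqxx orbT; clear -pq; lia.
apply: (joined_of_toggle (V := U') (s1 := SeqSub (inV _ in1))
  (s2 := SeqSub (inV _ in2)) Uoff Uon U'adm Uagree _ _ _ Uloop) => //; last first.
  by right; split=> //=; rewrite !inE eqxx orbT.
have rowP r : (r == r0) || (r == r0.+1) -> forall (z z' : vertex) c,
    c0 <= c < q - 1 -> val z = (r, c) -> val z' = (r, c + 1) -> e z z'.
  move=> rP z z' c /andP[pc cq] Ez Ez'.
  have cq' : c + 1 < q by clear -cq; lia.
  have := loop_row Uloop rP pc cq'; rewrite /e /edge_of Ez Ez'.
  by move=> /[dup] /(arrow_of_horizontal UU') -> ->.
have pq1 : c0 <= q - 1 by clear -pq; lia.
apply: (connect_trans (y := SeqSub (inV _ in3))).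
  by apply: (row_connect pq1) (rowP r0 _); rewrite ?eqxx.
apply: (connect_trans (y := SeqSub (inV _ in4))); last first.
  by rewrite e_sym; apply: (row_connect pq1) (rowP r0.+1 _); rewrite ?eqxx ?orbT.
have U1q : U r0 q by rewrite Uagree // xpair_eqE eqxx gt_eqF.
by apply: toggle_connect1; have [] := arrow_of_down Uq;
  have [] := arrow_of_down U1q.
Qed.

(** The relation e_a e_b e_a = e_a with b = a+1 or a-1: in [U] the smoothings of row a at p and p+2
    bound a loop on four vertices, and the flip removes its bottom or top edge. The other three
    edges are common. *)
Lemma joined_of_toggle_between (a : nat) (p : int) (b b' : endpoint n) :
  loop U a p (p + 2) -> c0 = p + 1 -> (r0 = a.+1 \/ r0.+1 = a) ->
  joined_of U b b' = joined_of U' b b'.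
Proof.
move=> Uloop Ec0 r0a; have [pq Up Uq Uin] := Uloop.
have inV x : in_loop a p (p + 2) x -> x \in vertices mu nu by exact: loop_vertex Uloop.
have inP r : (r == a) || (r == a.+1) ->
    in_loop a p (p + 2) (r, p) && in_loop a p (p + 2) (r, p + 1).
  by move=> rP; rewrite /in_loop /= rP /=; clear; lia.
have /andP[in1 in2] : in_loop a p (p + 2) (a, p) && in_loop a p (p + 2) (a, p + 1).
  by apply: inP; rewrite eqxx.
have /andP[in3 in4] : in_loop a p (p + 2) (a.+1, p) && in_loop a p (p + 2) (a.+1, p + 1).
  by apply: inP; rewrite eqxx orbT.
pose v1 : vertex := SeqSub (inV _ in1); pose v2 : vertex := SeqSub (inV _ in2).
pose v3 : vertex := SeqSub (inV _ in3); pose v4 : vertex := SeqSub (inV _ in4).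
have e13 : connect e v1 v3.
  by apply: toggle_connect1; [have [] := arrow_of_down Up
                             |have [] := arrow_of_down (UU' Up)].
have e24 : connect e v2 v4.
  have Eq : p + 2 - 1 = p + 1 by clear; lia.
  by apply: toggle_connect1; [have [_] := arrow_of_down Uq
    |have [_] := arrow_of_down (UU' Uq)]; rewrite /= Eq.
have [|U1 U2 U3] := Uin (p + 1); first by clear; lia.
case: r0a => r0a; subst c0.
  have e12 : connect e v1 v2.
    apply: toggle_connect1; rewrite /= eqxx ?U1 ?U2 //.
    by rewrite -!Uagree ?U1 ?U2 // xpair_eqE r0a; apply/negP => /andP[/eqP]; clear; lia.
  apply: (joined_of_toggle (s1 := v3) (s2 := v4) Uoff Uon U'adm Uagree _ _ _ Uloop) => //.
    by apply: (connect_trans _ e24); rewrite e_sym; apply: (connect_trans _ e13);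
       rewrite e_sym.
  by left; split=> //=; rewrite r0a addrK inE eqxx.
have e34 : connect e v3 v4.
  apply: toggle_connect1; rewrite /= eqxx ?U2 ?U3 //.
  by rewrite -!Uagree ?U2 ?U3 // xpair_eqE -r0a; apply/negP => /andP[/eqP]; clear; lia.
apply: (joined_of_toggle (s1 := v1) (s2 := v2) Uoff Uon U'adm Uagree _ _ _ Uloop) => //.
  by apply: (connect_trans e13); apply: (connect_trans e34); rewrite e_sym.
by left; split=> //=; rewrite r0a addrK !inE eqxx orbT.
Qed.

End LoopToggle.

End Diagram.

(** * Temperley-Lieb type *)

Lemma initial_run (P : nat -> bool) (m : nat) :
  P 1 -> ~~ P m.+1 ->
  exists2 l, 0 < l & (forall k, 0 < k <= l -> P k) /\ ~~ P l.+1.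
Proof.
move=> P1 Pm; have exP : exists m, ~~ P m.+1 by exists m.
case: (ex_minnP exP) => l Pl l_min; exists l.
  by case: l Pl {l_min} => //; rewrite P1.
split=> // -[|k] // /andP[_ kl]; apply/negPn/negP => /l_min.
by rewrite leqNgt kl.
Qed.

Section Key.

Local Open Scope ring_scope.

Variables (n : nat) (mu nu : n.-tuple nat) (i : nat) (T : filling).
Hypothesis T_tab : is_shuffle_tableau mu nu T.
Hypotheses (mu_part : is_partition mu) (nu_part : is_partition nu).
Hypotheses (mu3 : no_three_equal_parts mu) (nu3 : no_three_equal_parts nu).
Variables (r : nat) (c : int) (w1 w2 : seq position).
Hypothesis xP : unmatched_split i T (word mu nu i T) (pos r c) w1 w2.

Local Notation sq x := (x \in squares mu nu).
Local Notation w := (word mu nu i T).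

Let x_sq := split_square xP.
Let rn : (1 <= r <= n)%N. Proof. by case/squareP: x_sq. Qed.
Let rc : same_parity r c. Proof. by case/squareP: x_sq. Qed.
Let cl : row_start nu r <= c. Proof. by case/squareP: x_sq. Qed.
Let cr : c <= row_end mu r. Proof. by case/squareP: x_sq. Qed.

(** If x has entry i, strictness of the column suffices; if it has entry i+1, an i here would
    overlap with it. With [split_entry_below], the column around x has room for both i and i+1. *)
Lemma split_entry_above (r' : nat) : r = r'.+2 -> sq (pos r' c) ->
  (T (pos r' c) < i)%N.
Proof.
move=> Er r'P; have lt_r' : (T (pos r' c) < T (pos r c))%N.
  by apply: (st_col T_tab) => //; rewrite Er.
have [Tx|Tx] := split_entry xP; first by rewrite -Tx.
rewrite ltn_neqAle -ltnS -Tx lt_r' andbT; apply/eqP => r'i.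
have := split_not_overlap xP; rewrite Er => /negP; apply.
by apply: in_overlap_lower; rewrite -?Er.
Qed.

Lemma split_entry_below : sq (pos r.+2 c) -> (i.+1 < T (pos r.+2 c))%N.
Proof.
move=> r2P; have lt_r2 : (T (pos r c) < T (pos r.+2 c))%N.
  exact: (st_col T_tab).
have [Tx|Tx] := split_entry xP; last by rewrite -Tx.
rewrite ltn_neqAle -Tx lt_r2 andbT eq_sym; apply/negP => r2i.
by have := split_not_overlap xP; rewrite overlap_below // r2P -Tx r2i.
Qed.

(** One of [T0] and [T1] agrees with T; in the applications the other is E_iT or F_iT. *)
Let T0 := set_entry T (pos r c) i.+1.
Let T1 := set_entry T (pos r c) i.
Let U0 := uncrossed mu nu T0.
Let U1 := uncrossed mu nu T1.

Let T0x : T0 (pos r c) = i.+1. Proof. by rewrite /T0 /set_entry eqxx. Qed.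
Let T1x : T1 (pos r c) = i. Proof. by rewrite /T1 /set_entry eqxx. Qed.
Let T0E y : y != pos r c -> T0 y = T y.
Proof. by rewrite /T0 /set_entry => /negbTE ->. Qed.
Let T1E y : y != pos r c -> T1 y = T y.
Proof. by rewrite /T1 /set_entry => /negbTE ->. Qed.

Let ne_row (r' : nat) (c' : int) : r' <> r -> pos r' c' != pos r c.
Proof. by move=> ne; apply/eqP => -[]. Qed.
Let ne_col (r' : nat) (c' : int) : c' <> c -> pos r' c' != pos r c.
Proof. by move=> ne; apply/eqP => -[]. Qed.

(* The gain at (r-1, c+1) is done before the loss at (r, c): each of the two
   flips may need the generator that the other one affects. The condition is
   stated with r'+1 because r-1 is truncated. *)
Definition intermediate (r' : nat) (c' : int) : bool :=
  if (r'.+1, c') == (r, c + 1) then U1 r' c' else U0 r' c'.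

Lemma uncrossed_admissible (F : filling) : admissible mu nu (uncrossed mu nu F).
Proof. by move=> r' c'; rewrite uncrossedE // => /and4P[-> -> ->]. Qed.

Lemma intermediate_admissible : admissible mu nu intermediate.
Proof. by move=> r' c'; rewrite /intermediate; case: ifP => _ /uncrossed_admissible. Qed.

Lemma uncrossed_agree (r' : nat) (c' : int) :
  (r', c') != (r, c) -> (r'.+1, c') != (r, c + 1) -> U0 r' c' = U1 r' c'.
Proof.
move=> ne1 ne2; have ne4 : pos r'.+1 (c' - 1) != pos r c.
  by apply: contra ne2 => /eqP[-> <-]; rewrite subrK.
by rewrite /U0 /U1 !uncrossedE // !(T0E ne1) !(T0E ne4) !(T1E ne1) !(T1E ne4).
Qed.

(** * The generator gained at (r-1, c+1) *)

Section Gain.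

Variable r0 : nat.
Hypothesis Er : r = r0.+1.
Hypotheses (U0off : ~~ U0 r0 (c + 1)) (U1on : U1 r0 (c + 1)).

Let intermediateE (r' : nat) (c' : int) :
  (r', c') != (r0, c + 1) -> U0 r' c' = intermediate r' c'.
Proof.
move=> ne; rewrite /intermediate Er; case: eqP => // -[Er' Ec'].
by case/eqP: ne; rewrite Er' Ec'.
Qed.

(** The infinite values outside the shape are the same for [T0] and [T1], so the change comes from
    comparing two squares: i+1 exceeds the entry at (r0, c+1) but i does not. *)
Lemma gain_entry : sq (pos r0 (c + 1)) /\ T (pos r0 (c + 1)) = i.
Proof.
have ne : pos r0 (c + 1) != pos r c by apply: ne_row; rewrite Er; clear; lia.
have Ec : c + 1 - 1 = c by rewrite addrK.
move: U1on U0off; rewrite /U1 /U0 !uncrossedE // (T1E ne) (T0E ne) Ec -Er T0x T1x.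
case/and4P=> -> -> /andP[-> ->] /=; rewrite (ltNge c) cl /=.
rewrite !negb_or -leNgt -ltnNge => + /andP[cr0 Tz].
rewrite ltNge cr0 /= => Tz'; split; last by move: Tz Tz'; clear; lia.
have /and3P[rn0 rc0 /andP[cl0 _]] := uncrossed_admissible U1on.
by apply/squareP; split=> //; move: rn0; clear; lia.
Qed.

Let z_sq : sq (pos r0 (c + 1)). Proof. by case: gain_entry. Qed.
Let Tz : T (pos r0 (c + 1)) = i. Proof. by case: gain_entry. Qed.
Let r0n : (1 <= r0 < n)%N.
Proof. by have /and3P[] := uncrossed_admissible U1on. Qed.

Let Uon : intermediate r0 (c + 1).
Proof. by rewrite /intermediate Er eqxx. Qed.

(** The i+1 at (r+1, c+1) makes (r, c) and (r, c+2) uncrossed for [T0]; they bound a four-vertex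
    loop just below the gained position. No position under the loop is uncrossed, by
    [split_entry_below]. *)
Lemma joined_gain_overlap (b b' : endpoint n) :
  sq (pos r.+1 (c + 1)) -> T (pos r.+1 (c + 1)) = i.+1 ->
  joined_of mu nu U0 b b' = joined_of mu nu intermediate b b'.
Proof.
move=> yP Ty; have r1n : (1 <= r < n)%N by case/squareP: yP; move: rn; clear; lia.
have r1c : same_parity r.+1 (c + 1) by case/squareP: yP.
have yr : c + 1 <= row_end mu r.+1 by case/squareP: yP.
apply: (joined_of_toggle_between mu_part nu_part U0off Uon intermediate_admissible
  intermediateE (a := r) (p := c)) => //; last by right.
split; first by rewrite ltrDl.
- apply: uncrossed_intro => //; first by move: yr; clear; lia.
  move=> tP _; rewrite T0x T0E; last by apply: ne_row; clear; lia.
  by rewrite -Ty; apply: (st_row T_tab) => //; clear; lia.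
- apply: uncrossed_intro => //.
  + by move: rc; rewrite /same_parity; clear; lia.
  + by move: cl; clear; lia.
  + by move: yr; clear; lia.
  move=> _ tP; rewrite !T0E; [|by apply: ne_col; clear; lia|by apply: ne_row; clear; lia].
  have -> : c + 2 - 1 = c + 1 by clear; lia.
  by rewrite Ty; apply: split_entry_right tP; eassumption.
move=> t tP; have -> : t = c + 1 by move: tP; clear; lia.
split; first by rewrite Er.
  apply/negP => /uncrossed_admissible/and3P[_ + _]; move: rc.
  by rewrite /same_parity; clear; lia.
apply/negP => Ut; have /and3P[r1n' _ _] := uncrossed_admissible Ut.
have [start2 _] :=
  row_step2 mu_part nu_part mu3 nu3 (andP r1n).1 (andP r1n').2.
have [|//|t_sq _] := uncrossed_elim mu_part nu_part Ut.
  by rewrite addrK; exact: le_trans start2 cl.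
rewrite !T0E; [|by apply: ne_row; clear; lia|by apply: ne_row; clear; lia].
rewrite Ty; move: t_sq; rewrite addrK => /split_entry_below; clear; lia.
Qed.

(** The i's of row r-1 from column c+1 on form an unoverlapped run, of length l, and by
    [split_run_right] they face l letters i+1 in row r. The comparison at column c + 1 + 2l, just
    past the run, succeeds and closes the loop on the right. *)
Lemma joined_gain_run (b b' : endpoint n) :
  ~~ (sq (pos r.+1 (c + 1)) && (T (pos r.+1 (c + 1)) == i.+1)) ->
  joined_of mu nu U0 b b' = joined_of mu nu intermediate b b'.
Proof.
move=> no_overlap.
have c2_par k : same_parity r (c + 2 * k%:Z).
  by move: rc; rewrite /same_parity; clear; lia.
(* Otherwise (r+1, c+1), lying below (r-1, c+1), would have entry i+1. *)
have no_square s : c + 1 <= s -> ~ (sq (pos r.+1 s) /\ (T (pos r.+1 s) <= i.+1)%N).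
  move=> cs [sP Ts]; have y_sq : sq (pos r.+1 (c + 1)).
    rewrite Er in sP *.
    exact: (square_below mu_part nu_part mu3 nu3 z_sq sP (leqW (leqnSn r0))
      (esym (negbK _)) cs).
  case/negP: no_overlap; rewrite y_sq eqn_leq.
  rewrite (leq_trans (st_row T_tab y_sq sP cs) Ts) /= -{1}Tz.
  by apply: (st_col T_tab) => //; rewrite Er.
pose P k := sq (pos r0 (c - 1 + 2 * k%:Z)) && (T (pos r0 (c - 1 + 2 * k%:Z)) == i).
have P1 : P 1%N.
  by rewrite /P (_ : c - 1 + 2 * 1%:Z = c + 1) ?z_sq ?Tz ?eqxx //; clear; lia.
(* This index puts the column beyond the right end of row r0, so the run has stopped by then. *)
have [|l l_gt0 [Pl Pl1]] := @initial_run P `|row_end mu r0 - c|%N P1.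
  by apply/negP => /andP[/squareP[_ _ _]]; clear; lia.
have runP k : (0 < k <= l)%N ->
    pos r0 (c - 1 + 2 * k%:Z) \in w /\ T (pos r0 (c - 1 + 2 * k%:Z)) = i.
  move=> /[dup] kl /Pl /andP[kP /eqP Tk]; split=> //.
  rewrite mem_word kP Tk eqxx /= overlap_below //; apply/negP => /andP[k2P /eqP Tk2].
  rewrite -Er in k2P Tk2; apply: (no_square (c - 1 + 2 * k%:Z)).
    by move: kl; clear; lia.
  by rewrite Tk2.
have rowP := split_run_right T_tab mu_part nu_part mu3 nu3 xP Er runP.
have row_sq k : (0 < k <= l)%N -> sq (pos r (c + 2 * k%:Z)).
  by move=> /rowP[]; rewrite mem_word => /andP[].
have r0_start : row_start nu r0 <= c + 1 by case/squareP: z_sq.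
have [r_start r_end] := row_step mu_part nu_part r0n; rewrite -Er in r_start r_end.
have l_end : c + 2 * l%:Z <= row_end mu r.
  by have [|_ _ _] := squareP _ _ _ _ (row_sq l _); rewrite ?l_gt0 ?leqnn.
apply: (joined_of_toggle_left mu_part nu_part U0off Uon intermediate_admissible
  intermediateE (q := c + 1 + 2 * l%:Z)).
split=> //; first by move: l_gt0; clear; lia.
  rewrite -intermediateE; last first.
    by apply/eqP => -[] /eqP; move: l_gt0; clear; lia.
  apply: uncrossed_intro => //.
  - by move: (c2_par l); rewrite Er /same_parity; clear; lia.
  - by move: r0_start; clear; lia.
  - by rewrite -Er; move: l_end; clear; lia.
  rewrite (_ : c + 1 + 2 * l%:Z - 1 = c + 2 * l%:Z); last by clear; lia.
  move=> _ tP; rewrite -Er !T0E; [|by apply: ne_row; rewrite Er; clear; lia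
                                  |by apply: ne_col; move: l_gt0; clear; lia].
  have [|_ ->] := rowP l; first by rewrite l_gt0 leqnn.
  move: Pl1; rewrite /P (_ : c - 1 + 2 * l.+1%:Z = c + 1 + 2 * l%:Z); last by clear; lia.
  rewrite tP /= => Ti; have := st_row T_tab z_sq tP _; rewrite Tz.
  by rewrite ltn_neqAle eq_sym Ti lerDl; apply; clear; lia.
move=> t /andP[tl tr].
have inter_t r' : intermediate r' t -> U0 r' t.
  by rewrite intermediateE //; apply/eqP => -[_] /eqP; move: tl; clear; lia.
have t_ne r' : pos r' t != pos r c by apply: ne_col; move: tl; clear; lia.
have t1_ne r' : pos r' (t - 1) != pos r c by apply: ne_col; move: tl; clear; lia.
have tk : same_parity r t -> exists2 k, (0 < k <= l)%N & t = c + 2 * k%:Z.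
  move=> rt; exists `|((t - c) %/ 2)%Z|%N; move: rt rc tl tr; rewrite /same_parity.
    by clear; lia.
  by clear; lia.
(* Row r0 - 1: there would be an i at (r-2, t), overlapping the letter i+1 at (r, t). Row r0: the
   comparison reads i+1 <= i. Row r: (r+1, t-1) would have an entry at most i+1, against
   [no_square]. *)
split; apply/negP => /inter_t Ut; have /and3P[r'n rt _] := uncrossed_admissible Ut.
- case Er0: r0 r'n rt Ut => [//|r'] /= r'n rt Ut.
  have [k kl Et] : exists2 k, (0 < k <= l)%N & t = c + 2 * k%:Z.
    by apply: tk; rewrite Er Er0; move: rt; rewrite /same_parity; clear; lia.
  have [kw Tk] := rowP k kl; have k_sq := row_sq k kl.
  have r'_n2 : (r'.+2 <= n)%N by move: rn; rewrite Er Er0; clear; lia.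
  have [_ r'_end] := row_step2 mu_part nu_part mu3 nu3 (andP r'n).1 r'_n2.
  have [||_ t_sq] := uncrossed_elim mu_part nu_part Ut.
  + by rewrite -Er0; move: r0_start tl; clear; lia.
  + apply: le_trans r'_end; rewrite -Er0 -Er Et; by case/squareP: k_sq.
  rewrite !T0E // -Er0.
  have kP : sq (pos r0 (t - 1)) /\ T (pos r0 (t - 1)) = i.
    rewrite (_ : t - 1 = c - 1 + 2 * k%:Z); last by rewrite Et; clear; lia.
    by have [] := runP k kl; rewrite mem_word => /andP[].
  rewrite kP.2 => le_i; have Er2 : r = r'.+2 by rewrite Er Er0.
  have lt_i : (T (pos r' t) < T (pos r t))%N.
    by apply: (st_col T_tab) => //; rewrite ?Er2 // Et -Er2.
  have Tt : T (pos r' t) = i.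
    by move: lt_i le_i; rewrite Et Tk; clear; lia.
  move: kw; rewrite mem_word -Et => /and3P[_ _ /negP]; apply.
  rewrite Er2; apply: in_overlap_lower => //; rewrite -Er2 Et //.
- have [k kl Et] : exists2 k, (0 < k.+1 <= l)%N & t = c + 1 + 2 * k%:Z.
    exists `|((t - c - 1) %/ 2)%Z|%N; move: rt rc tl tr; rewrite Er /same_parity.
      by clear; lia.
    by clear; lia.
  have k_gt0 : (0 < k <= l)%N by move: kl tl; rewrite Et; clear; lia.
  have [kw Tk] := rowP k k_gt0.
  have Et1 : t - 1 = c + 2 * k%:Z by rewrite Et; clear; lia.
  have [] := runP k.+1 kl; rewrite mem_word (_ : c - 1 + 2 * k.+1%:Z = t); last first.
    by rewrite Et; clear; lia.
  case/andP=> t_sq _ Tt; have [||_ _] := uncrossed_elim mu_part nu_part Ut.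
  + by rewrite -Er; move: cl tl; clear; lia.
  + by case/squareP: t_sq.
  by rewrite -Er !T0E // Et1 Tk Tt ltnn.
rewrite -Er in r'n rt Ut.
have [k kl Et] := tk rt; have [kw Tk] := rowP k kl; have k_sq := row_sq k kl.
have [r1_start _] := row_step mu_part nu_part r'n.
have [||t1_sq _] := uncrossed_elim mu_part nu_part Ut.
- by move: r1_start cl tl; clear; lia.
- by rewrite Et; case/squareP: k_sq.
rewrite !T0E // Et Tk -Et => le_i; apply: (no_square (t - 1)) => //.
by move: tl; rewrite Et; move: kl; clear; lia.
Qed.

End Gain.

(** * The generator lost at (r, c) *)

Section Lose.

Hypotheses (U0on : U0 r c) (U1off : ~~ U1 r c).

Let intermediate_off (r' : nat) (c' : int) :
  (r'.+1, c') != (r, c + 1) -> intermediate r' c' = U0 r' c'.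
Proof. by rewrite /intermediate => /negbTE ->. Qed.

Let Uon : intermediate r c.
Proof. by rewrite intermediate_off //; apply/eqP => -[]; clear; lia. Qed.

Let intermediateE (r' : nat) (c' : int) :
  (r', c') != (r, c) -> U1 r' c' = intermediate r' c'.
Proof.
by move=> ne; rewrite /intermediate; case: ifPn => // /(uncrossed_agree ne) ->.
Qed.

Lemma lose_entry : sq (pos r.+1 (c - 1)) /\ T (pos r.+1 (c - 1)) = i.+1.
Proof.
have ne : pos r.+1 (c - 1) != pos r c by apply: ne_row; clear; lia.
have /and3P[r1n _ /andP[_ c_end]] := uncrossed_admissible U0on.
move: U0on U1off; rewrite /U1 /U0 !uncrossedE // (T1E ne) (T0E ne) T0x T1x.
case/and4P=> -> -> /andP[-> ->] /=; rewrite (ltNge _ c) cr /=.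
rewrite !negb_or -leNgt -ltnNge => + /andP[cl1 Ty].
rewrite ltNge cl1 /= => Ty'; split; last by move: Ty Ty'; clear; lia.
apply/squareP; split=> //; first by move: r1n; clear; lia.
  by move: rc; rewrite /same_parity; clear; lia.
by move: c_end; clear; lia.
Qed.

Let y_sq : sq (pos r.+1 (c - 1)). Proof. by case: lose_entry. Qed.
Let Ty : T (pos r.+1 (c - 1)) = i.+1. Proof. by case: lose_entry. Qed.
Let r1n : (1 <= r < n)%N.
Proof. by have /and3P[] := uncrossed_admissible U0on. Qed.

(** Here the four-vertex loop lies above the lost position, between (r-1, c-1) and (r-1, c+1). Its
    left end comes from [split_entry_left]; its right end compares the entry i that x has in [T1]
    with an entry to the right of the i at (r-1, c-1). *)
Lemma joined_lose_overlap (r0 : nat) (b b' : endpoint n) : r = r0.+1 ->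
  sq (pos r0 (c - 1)) -> T (pos r0 (c - 1)) = i ->
  joined_of mu nu U1 b b' = joined_of mu nu intermediate b b'.
Proof.
move=> Er zP Tz; have r0n : (1 <= r0 < n)%N.
  by case/squareP: zP; move: r1n; rewrite Er; clear; lia.
have r0c : same_parity r0 (c - 1) by case/squareP: zP.
have zl : row_start nu r0 <= c - 1 by case/squareP: zP.
have Ec : c = c - 1 + 1 by rewrite subrK.
apply: (joined_of_toggle_between mu_part nu_part U1off Uon intermediate_admissible
  intermediateE (a := r0) (p := c - 1) _ _ _ Ec); last by left.
split; first by rewrite ltrDl.
- apply: uncrossed_intro => //; first by rewrite -Er; move: cr; clear; lia.
  rewrite -Er => tP _; rewrite !T1E; [|by apply: ne_row; rewrite Er; clear; lia
                                     |by apply: ne_col; clear; lia].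
  have Ec2 : c - 1 - 1 = c - 2 by clear; lia.
  by rewrite Ec2 in tP *; rewrite Tz; apply: split_entry_left tP; eassumption.
- apply: uncrossed_intro => //.
  + by move: r0c; rewrite /same_parity; clear; lia.
  + by move: zl; clear; lia.
  + by rewrite -Er; move: cr; clear; lia.
  have Ec1 : c - 1 + 2 - 1 = c by clear; lia.
  rewrite Ec1 -Er T1x => _ tP; rewrite T1E; last by apply: ne_row; rewrite Er; clear; lia.
  by rewrite -Tz; apply: (st_row T_tab) => //; clear; lia.
move=> t tP; have -> : t = c by move: tP; clear; lia.
rewrite -Er U1off; split=> //; last first.
  apply/negP => /uncrossed_admissible/and3P[_ + _]; move: r0c.
  by rewrite /same_parity; clear; lia.
apply/negP => Ut; have /and3P[r'n _ _] := uncrossed_admissible Ut.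
case Er0: r0 zl zP Tz r'n Ut => [//|r'] /= zl zP Tz r'n Ut.
have Er2 : r = r'.+2 by rewrite Er Er0.
have r'n2 : (r'.+2 <= n)%N by rewrite -Er2; move: rn; clear; lia.
have [_ r'_end] := row_step2 mu_part nu_part mu3 nu3 (andP r'n).1 r'n2.
have [||_ t_sq] := uncrossed_elim mu_part nu_part Ut; first exact: zl.
  by apply: le_trans r'_end; rewrite -Er2.
rewrite !T1E; [|by apply: ne_row; rewrite Er2; clear; lia
               |by apply: ne_col; clear; lia].
by rewrite Tz leqNgt (split_entry_above Er2 t_sq).
Qed.

(** Half-turn of [joined_gain_run]: the run of i+1's of row r+1 ending at column c - 1 faces l
    letters i in row r, and the comparison with the entry just left of the run gives the left end of
    the loop. *)
Lemma joined_lose_run (b b' : endpoint n) :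
  (forall r0, r = r0.+1 -> ~~ (sq (pos r0 (c - 1)) && (T (pos r0 (c - 1)) == i))) ->
  joined_of mu nu U1 b b' = joined_of mu nu intermediate b b'.
Proof.
move=> no_overlap.
have c2_par k : same_parity r (c - 2 * k%:Z).
  by move: rc; rewrite /same_parity; clear; lia.
(* Otherwise (r-1, c-1), lying above (r+1, c-1), would have entry i. *)
have no_square r0 s : r = r0.+1 -> s <= c - 1 ->
    ~ (sq (pos r0 s) /\ (i <= T (pos r0 s))%N).
  move=> Er cs [sP Ts]; have z_sq : sq (pos r0 (c - 1)).
    have y_sq' := y_sq; rewrite Er in y_sq'.
    exact: (square_above mu_part nu_part mu3 nu3 sP y_sq' (leqW (leqnSn r0))
      (esym (negbK _)) cs).
  case/negP: (no_overlap r0 Er); rewrite z_sq /= eqn_leq andbC.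
  rewrite (leq_trans Ts (st_row T_tab sP z_sq cs)) /= -ltnS -Ty.
  by apply: (st_col T_tab) => //; rewrite Er.
pose P k := sq (pos r.+1 (c + 1 - 2 * k%:Z)) && (T (pos r.+1 (c + 1 - 2 * k%:Z)) == i.+1).
have P1 : P 1%N.
  by rewrite /P (_ : c + 1 - 2 * 1%:Z = c - 1) ?y_sq ?Ty ?eqxx //; clear; lia.
have [|l l_gt0 [Pl Pl1]] := @initial_run P `|c - row_start nu r.+1|%N P1.
  by apply/negP => /andP[/squareP[_ _ + _]]; clear; lia.
have runP k : (0 < k <= l)%N ->
    pos r.+1 (c + 1 - 2 * k%:Z) \in w /\ T (pos r.+1 (c + 1 - 2 * k%:Z)) = i.+1.
  move=> /[dup] kl /Pl /andP[kP /eqP Tk]; split=> //.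
  rewrite mem_word kP Tk eqxx orbT /=; apply/negP.
  move=> /(overlap_above T_tab mu_part nu_part mu3 nu3 kP Tk)[r0 [[Er] k0P Tk0]].
  apply: (no_square r0 (c + 1 - 2 * k%:Z)) => //; last by rewrite Tk0.
  by move: kl; clear; lia.
have rowP := split_run_left T_tab mu_part nu_part mu3 nu3 xP runP.
have row_sq k : (0 < k <= l)%N -> sq (pos r (c - 2 * k%:Z)).
  by move=> /rowP[]; rewrite mem_word => /andP[].
have [r1_start r1_end] := row_step mu_part nu_part r1n.
have y_end : c - 1 <= row_end mu r.+1 by case/squareP: y_sq.
have l_start : row_start nu r <= c - 2 * l%:Z.
  by have [|_ _] := squareP _ _ _ _ (row_sq l _); rewrite ?l_gt0 ?leqnn.
apply: (joined_of_toggle_right mu_part nu_part U1off Uon intermediate_admissible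
  intermediateE (p := c - 2 * l%:Z)).
split=> //; first by move: l_gt0; clear; lia.
  rewrite intermediate_off; last by apply/eqP => -[]; clear; lia.
  apply: uncrossed_intro => //; first by move: y_end; clear; lia.
  rewrite (_ : c - 2 * l%:Z - 1 = c + 1 - 2 * l.+1%:Z); last by clear; lia.
  move=> tP _; rewrite !T0E; [|by apply: ne_col; move: l_gt0; clear; lia
                              |by apply: ne_row; clear; lia].
  have [|_ ->] := rowP l; first by rewrite l_gt0 leqnn.
  move: Pl1; rewrite /P tP /= => Ti; rewrite -ltnS ltn_neqAle Ti -Ty.
  by apply: (st_row T_tab) => //; clear; lia.
move=> t /andP[tl tr].
have inter_t r' : intermediate r' t -> U0 r' t.
  by rewrite intermediate_off //; apply/eqP => -[_]; move: tr; clear; lia.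
have t_ne r' : pos r' t != pos r c by apply: ne_col; move: tr; clear; lia.
have t1_ne r' : pos r' (t - 1) != pos r c by apply: ne_col; move: tr; clear; lia.
have tk : ~~ same_parity r t -> exists2 k, (0 < k <= l)%N & t = c + 1 - 2 * k%:Z.
  move=> rt; exists `|((c + 1 - t) %/ 2)%Z|%N; move: rt rc tl tr; rewrite /same_parity.
    by clear; lia.
  by clear; lia.
have t1E k : t = c + 1 - 2 * k%:Z -> t - 1 = c - 2 * k%:Z by move=> ->; clear; lia.
(* Row r - 1: (r-1, t) would have an entry at least i, against [no_square]. Row r: the comparison
   reads i+1 <= i. Row r + 1: there would be an i+1 at (r+2, t-1), overlapping the letter i at (r,
   t-1). *)
split; apply/negP => /inter_t Ut; have /and3P[r'n rt _] := uncrossed_admissible Ut.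
- have r_gt0 : (0 < r)%N by case/andP: r1n.
  have Er : r = r.-1.+1 by rewrite prednK.
  have [|k kl Et] := tk; first by rewrite Er same_parityS rt.
  have [kw Tk] := rowP k kl; have k_sq := row_sq k kl.
  have [_ r_end] := row_step mu_part nu_part r'n; rewrite prednK // in r_end.
  have [||_ t_sq] := uncrossed_elim mu_part nu_part Ut.
  + by rewrite prednK // (t1E k) //; case/squareP: k_sq.
  + by move: r_end cr tr; clear; lia.
  rewrite prednK // !T0E // (t1E k) // Tk => le_i; apply: (no_square r.-1 t) => //.
  by move: tr; rewrite Et; move: kl; clear; lia.
- have [k kl Et] : exists2 k, (0 < k < l)%N & t = c - 2 * k%:Z.
    exists `|((c - t) %/ 2)%Z|%N; move: rt rc tl tr; rewrite /same_parity.
      by clear; lia.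
    by clear; lia.
  have k_le : (0 < k <= l)%N by move: kl; clear; lia.
  have [kw Tk] := rowP k k_le.
  have Et1 : t - 1 = c + 1 - 2 * k.+1%:Z by rewrite Et; clear; lia.
  have [|] := runP k.+1; first by move: kl; clear; lia.
  rewrite mem_word -Et1 => /andP[t1_sq _] Tt1.
  have [||_ _] := uncrossed_elim mu_part nu_part Ut.
  + by case/squareP: t1_sq.
  + by move: cr tr; clear; lia.
  by rewrite !T0E // Tt1 Et Tk ltnn.
have [|k kl Et] := tk.
  by move: rt; rewrite same_parityS.
have [kw Tk] := rowP k kl; have k_sq := row_sq k kl.
have [] := runP k kl; rewrite mem_word -Et => /andP[t_sq _] Tt.
have r2n : (r.+2 <= n)%N by move: r'n; clear; lia.
have [r2_start _] := row_step2 mu_part nu_part mu3 nu3 (andP r1n).1 r2n.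
have [||t1_sq _] := uncrossed_elim mu_part nu_part Ut.
- by rewrite (t1E k) //; apply: le_trans r2_start _; case/squareP: k_sq.
- by case/squareP: t_sq.
rewrite !T0E // Tt => le_i; rewrite (t1E k) // in t1_sq le_i.
have lt_i := st_col T_tab k_sq t1_sq (leqnSn _).
move: kw; rewrite mem_word overlap_below // => /and3P[_ _ /negP]; apply.
by rewrite t1_sq eqn_leq le_i -Tk.
Qed.

End Lose.

Lemma joined_crystal (b b' : endpoint n) :
  joined mu nu T0 b b' = joined mu nu T1 b b'.
Proof.
have joinedE F : joined mu nu F b b' = joined_of mu nu (uncrossed mu nu F) b b' by [].
have joined_of_ext U V : U =2 V -> joined_of mu nu U b b' = joined_of mu nu V b b'.
  move=> UV; apply: eq_existsb => x; apply: eq_existsb => y; do 2 congr (_ && _).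
  apply: eq_connect => z z'; rewrite /edge_of /arrow_of.
  by case: (val z) => ? ?; case: (val z') => ? ?; rewrite !UV.
(* Lowering x helps the comparison in which x is the lower square and hurts the one in which it is
   the upper square, so (r-1, c+1) can only be gained and (r, c) only lost. *)
have U01 r0 : r = r0.+1 -> U0 r0 (c + 1) -> U1 r0 (c + 1).
  move=> Er; have ne : pos r0 (c + 1) != pos r c by apply: ne_row; rewrite Er; clear; lia.
  rewrite /U0 /U1 !uncrossedE // (T0E ne) (T1E ne) addrK -Er T0x T1x.
  case/and4P=> -> -> -> /=; case: (_ < _) => //=; case: (_ < _) => //=.
  exact: leq_trans.
have U10 : U1 r c -> U0 r c.
  have ne : pos r.+1 (c - 1) != pos r c by apply: ne_row; clear; lia.
  rewrite /U0 /U1 !uncrossedE // (T0E ne) (T1E ne) T0x T1x.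
  case/and4P=> -> -> -> /=; case: (_ < _) => //=; case: (_ < _) => //=.
  exact: leqW.
rewrite !joinedE; transitivity (joined_of mu nu intermediate b b').
  have r_gt0 : (0 < r)%N by case/andP: rn.
  have Er : r = r.-1.+1 by rewrite prednK.
  (* For r = 1 both sides are false, row 0 being out of range, so this falls into the case without a
     gain. *)
  have [U0U1|] := eqVneq (U0 r.-1 (c + 1)) (U1 r.-1 (c + 1)).
    apply: joined_of_ext => r' c'; rewrite /intermediate.
    by case: eqP => // -[]; rewrite Er => -[-> ->].
  case U1r: (U1 _ _); last first.
    by rewrite eqbF_neg negbK => /(U01 _ Er) U1r'; rewrite U1r' in U1r.
  rewrite eqb_id => U0r.
  case: (boolP (sq (pos r.+1 (c + 1)) && (T (pos r.+1 (c + 1)) == i.+1))).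
    by case/andP=> y_sq /eqP Ty; apply: joined_gain_overlap Er U0r U1r _ _ y_sq Ty.
  exact: joined_gain_run Er U0r U1r _ _.
apply/esym; have [U0U1|] := eqVneq (U0 r c) (U1 r c).
  apply: joined_of_ext => r' c'; rewrite /intermediate; case: ifPn => // ne.
  have [[-> ->]|ne'] := eqVneq (r', c') (r, c); first by [].
  by rewrite (uncrossed_agree ne' ne).
case U1r: (U1 r c); first by rewrite (U10 U1r) eqxx.
rewrite eqbF_neg negbK => U0r; have {}U1r := negbT U1r.
case: (boolP [&& (0 < r)%N, sq (pos r.-1 (c - 1)) & T (pos r.-1 (c - 1)) == i]).
  case/and3P=> r_gt0 z_sq /eqP Tz.
  by apply: (joined_lose_overlap U0r U1r _ _ _ z_sq Tz); rewrite prednK.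
move=> no_overlap; apply: joined_lose_run U0r U1r _ _ _ => r0 Er.
by move: no_overlap; rewrite {1 2 3}Er.
Qed.

End Key.

Lemma psi_ext (n : nat) (mu nu : n.-tuple nat) (F G : filling) :
  (forall b b', joined mu nu F b b' = joined mu nu G b b') ->
  psi mu nu F = psi mu nu G.
Proof.
move=> FG; rewrite /psi; apply: eq_finset => S.
by apply: eq_existsb => b; apply: eq_existsb => b'; rewrite FG.
Qed.

(** Fillings are functions, and resetting an entry to its own value gives a filling equal to [F]
    only pointwise. This lets T be replaced by the [T0] or [T1] that it agrees with. *)
Lemma joined_set_entry (n : nat) (mu nu : n.-tuple nat) (F : filling)
    (x : position) (b b' : endpoint n) :
  joined mu nu (set_entry F x (F x)) b b' = joined mu nu F b b'.
Proof.
have setE y : set_entry F x (F x) y = F y by rewrite /set_entry; case: eqP => // ->.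
have UE r c : uncrossed mu nu (set_entry F x (F x)) r c = uncrossed mu nu F r c.
  by rewrite /uncrossed /value !setE.
apply: eq_existsb => y; apply: eq_existsb => y'; do 2 congr (_ && _).
apply: eq_connect => z z'; rewrite /edge /arrow.
by case: (val z) => ? ?; case: (val z') => ? ?; rewrite !UE.
Qed.

Theorem proposition4p7 (n : nat) (mu nu : n.-tuple nat)
  (mu_part : is_partition mu) (nu_part : is_partition nu)
  (mu3 : no_three_equal_parts mu) (nu3 : no_three_equal_parts nu)
  (T : filling) (T_tab : is_shuffle_tableau mu nu T)
  (i : nat) (i_ge1 : 1 <= i) :
  (forall ET : filling, crystal_E mu nu i T = Some ET ->
     psi mu nu ET = psi mu nu T) /\
  (forall FT : filling, crystal_F mu nu i T = Some FT ->
     psi mu nu FT = psi mu nu T).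
Proof.
split=> [ET /crystal_EP|FT /crystal_FP] [[r c] [-> Tx [w1 [w2 xP]]]];
  apply: psi_ext => b b'; rewrite -[RHS](joined_set_entry mu nu T (r, c)) Tx.
  exact/esym/(joined_crystal T_tab mu_part nu_part mu3 nu3 xP).
exact: (joined_crystal T_tab mu_part nu_part mu3 nu3 xP).
Qed.
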